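(* Let $n\ge1$, let $\xi$ be an essential assignment on the equi-oriented commutative ladder $\mathrm{CL}(n)$, and let $M$ be a representation of $\mathrm{CL}(n)$. Let $$\underline{M}=\bigl(M_{(1,1)}\to M_{(2,1)}\to\cdots\to M_{(n,1)}\bigr),\qquad \overline{M}=\bigl(M_{(1,2)}\to M_{(2,2)}\to\cdots\to M_{(n,2)}\bigr)$$ be the lower and upper rows of $M$, regarded as representations of the equi-oriented quiver $\vec{A}_n=(1\to2\to\cdots\to n)$. Let $\mathcal{V}\colon\mathbb{I}_1\sqcup\mathbb{I}_2\to\mathrm{rep}(\vec{A}_n)$ be the map sending $[b,d]_i$ to the interval representation $V_{[b,d]}$ of $\vec{A}_n$ supported on $\{b,b+1,\dots,d\}$. Then $$d_{\underline{M}}\circ\mathcal{V}|_{\mathbb{I}_1}=\widetilde{\delta}^{\xi}_M\big|_{\mathbb{I}_1}\qquad\text{and}\qquad d_{\overline{M}}\circ\mathcal{V}|_{\mathbb{I}_2}=\widetilde{\delta}^{\xi}_M\big|_{\mathbb{I}_2}.$$ That is, for all $1\le b\le d\le n$, the multiplicity of $V_{[b,d]}$ in $\underline{M}$ equals $\widetilde{\delta}^\xi_M([b,d]_1)$ and the multiplicity of $V_{[b,d]}$ in $\overline{M}$ equals $\widetilde{\delta}^\xi_M([b,d]_2)$, irrespective of the choice of $\xi$.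
   Context: Fix a field $\Bbbk$. The equi-oriented commutative ladder $\mathrm{CL}(n)$ is the quiver $Q$ with vertex set $Q_0=\{1,\dots,n\}\times\{1,2\}$ and arrows $(i,j)\to(i+1,j)$ and $(i,1)\to(i,2)$, with the relations that all squares commute. Row $1$ is the lower row and row $2$ the upper row. Paths include trivial (length-zero) paths. A representation $M$ assigns a finite-dimensional $\Bbbk$-vector space $M_u$ to each vertex and a linear map to each arrow, such that parallel paths have equal composites. If there is a path from $u$ to $v$, $M(u\to v)\colon M_u\to M_v$ denotes the common composite (the identity if $u=v$). Multiplicity: by Krull–Schmidt, every finite-dimensional representation $N$ of a finite acyclic quiver (with or without relations) decomposes uniquely up to isomorphism into indecomposables; $d_N(L)$ denotes the multiplicity of (the isomorphism class of) the indecomposable $L$ in $N$. Interval: a nonempty full subquiver $I$ of a quiver, with vertex set $I_0$, that is connected and convex (every path starting and ending in $I_0$ has all vertices in $I_0$). Intervals are ordered by $I\le J\iff I_0\subseteq J_0$. The interval representation $V_I$ is $\Bbbk$ on $I_0$ and $0$ elsewhere, with identity maps on arrows having both ends in $I_0$ and zero maps otherwise. Write $[b,d]_i$ for the set of vertices $(b,i),(b+1,i),\dots,(d,i)$ in row $i$. The set $\mathbb{I}$ of intervals of $\mathrm{CL}(n)$ is $\mathbb{I}=\mathbb{I}_1\sqcup\mathbb{I}_2\sqcup\mathbb{I}_{2/1}$ with $\mathbb{I}_i=\{[b,d]_i:1\le b\le d\le n\}$ for $i=1,2$ and $\mathbb{I}_{2/1}=\{[b_1,d_1]_1\sqcup[b_2,d_2]_2:1\le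 b_2\le b_1\le d_2\le d_1\le n\}$ (intervals identified with their vertex sets). Essential vertices: $E(I)$ is the set of vertices of $I$ that are a source or a sink of $I$. Course: a pair $(C,F)$ with $C=(C_0,C_1)$ a connected (finite, acyclic) quiver and $F\colon C_0\to Q_0$ a map such that for every arrow $a\to b$ of $C$ there is a path in $Q$ from $F(a)$ to $F(b)$. It is an essential course in $I$ if $E(I)\subseteq F(C_0)\subseteq I_0$. An essential assignment $\xi$ assigns to each $I\in\mathbb{I}$ an essential course $\xi(I)$ in $I$. Tour: $\mathrm{Tour}_{(C,F)}(M)$ is the representation of $C$ (without relations) with space $M_{F(a)}$ at $a\in C_0$ and map $M(F(a)\to F(b))$ at each arrow $a\to b$ of $C$. $\xi$-compressed multiplicity: $c^\xi_M(I):=d_{\mathrm{Tour}_{\xi(I)}(M)}\bigl(\mathrm{Tour}_{\xi(I)}(V_I)\bigr)$ (the representation $\mathrm{Tour}_{\xi(I)}(V_I)$ is indecomposable). Interval approximation: $\delta^\xi_M\colon\mathbb{I}\to\mathbb{Z}$ is the (unique) function with $c_M^{\xi}(I)=\sum_{J\in\mathbb{I},\,I\le J}\delta^\xi_M(J)$ for every $I\in\mathbb{I}$. Auxiliary function $\widetilde{\delta}^\xi_M\colon\mathbb{I}\to\mathbb{Z}$: for fixed $b_1,d_1$, $\widetilde{\delta}^\xi_M([b_1,d_1]_1)=\delta^\xi_M([b_1,d_1]_1)+\sum\delta^\xi_M([b_2,d_2]_2\sqcup[b_1,d_1]_1)$, summed over all $(b_2,d_2)$ with $[b_2,d_2]_2\sqcup[b_1,d_1]_1\in\mathbb{I}_{2/1}$;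 for fixed $b_2,d_2$, $\widetilde{\delta}^\xi_M([b_2,d_2]_2)=\delta^\xi_M([b_2,d_2]_2)+\sum\delta^\xi_M([b_2,d_2]_2\sqcup[b_1,d_1]_1)$, summed over all $(b_1,d_1)$ with $[b_2,d_2]_2\sqcup[b_1,d_1]_1\in\mathbb{I}_{2/1}$; and $\widetilde{\delta}^\xi_M=\delta^\xi_M$ on $\mathbb{I}_{2/1}$. *)

(* Defs.v *)
From HB Require Import structures.
From mathcomp Require Import all_boot all_order all_algebra.
From mathcomp Require Import boolp.

Set Implicit Arguments.
Unset Strict Implicit.
Unset Printing Implicit Defensive.

Import GRing.Theory.

Record quiver := Quiver {
  vertex :> finType;
  arrow : finType;
  src : arrow -> vertex;
  tgt : arrow -> vertex }.

Inductive qpath (Q : quiver) : Q -> Q -> Type :=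
| qnil u : qpath u u
| qcons (a : arrow Q) v : qpath (tgt a) v -> qpath (src a) v.

Fixpoint qvertices (Q : quiver) (u v : Q) (p : qpath u v) : seq Q :=
  match p with
  | qnil u => [:: u]
  | qcons a _ p' => src a :: qvertices p'
  end.

Definition qacyclic (Q : quiver) : Prop :=
  forall a : arrow Q, ~ inhabited (qpath (tgt a) (src a)).

(* Adjacency in the underlying undirected graph of the full subquiver on I. *)
Definition adjacent_in (Q : quiver) (I : {set Q}) : rel Q :=
  [rel u v | [&& u \in I, v \in I &
    [exists a : arrow Q, ((src a == u) && (tgt a == v))
                      || ((src a == v) && (tgt a == u))]]].

Definition connected_on (Q : quiver) (I : {set Q}) : Prop :=
  {in I &, forall u v, connect (adjacent_in I) u v}.

Definition qconnected (Q : quiver) : Prop :=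
  0 < #|Q| /\ connected_on [set: Q].

Definition qconvex (Q : quiver) (I : {set Q}) : Prop :=
  forall (u v : Q) (p : qpath u v),
    u \in I -> v \in I -> {subset qvertices p <= I}.

Definition is_qinterval (Q : quiver) (I : {set Q}) : Prop :=
  [/\ I != set0, connected_on I & qconvex I].

(* An interval, being a full subquiver, is identified with its vertex set. *)
Record qinterval (Q : quiver) := QInterval {
  qinterval_set :> {set Q};
  qintervalP : `[< is_qinterval qinterval_set >] }.

HB.instance Definition _ (Q : quiver) := [isSub for @qinterval_set Q].
HB.instance Definition _ (Q : quiver) := [Finite of qinterval Q by <:].

Definition source_in (Q : quiver) (I : {set Q}) (u : Q) : bool :=
  [forall a : arrow Q, (tgt a == u) ==> (src a \notin I)].

Definition sink_in (Q : quiver) (I : {set Q}) (u : Q) : bool :=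
  [forall a : arrow Q, (src a == u) ==> (tgt a \notin I)].

Definition essential_vertices (Q : quiver) (I : {set Q}) : {set Q} :=
  [set u in I | source_in I u || sink_in I u].

Record rep (k : fieldType) (Q : quiver) := Rep {
  rspace :> Q -> vectType k;
  rmap : forall a : arrow Q, 'Hom(rspace (src a), rspace (tgt a)) }.

Arguments rmap {k Q} r a.

Fixpoint composite (k : fieldType) (Q : quiver) (M : rep k Q) (u v : Q)
    (p : qpath u v) : 'Hom(M u, M v) :=
  match p with
  | qnil u => \1%VF
  | qcons a v p' => (composite M p' \o rmap M a)%VF
  end.

(* The relations of the quivers considered here: parallel paths have equal
   composites. *)
Definition commutative_rep (k : fieldType) (Q : quiver) (M : rep k Q) : Prop :=
  forall (u v : Q) (p q : qpath u v), composite M p = composite M q.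

(* M(u -> v), through an arbitrary path; when M is commutative the result does
   not depend on the path. *)
Definition transition (k : fieldType) (Q : quiver) (M : rep k Q) (u v : Q)
    (uv : inhabited (qpath u v)) : 'Hom(M u, M v) :=
  composite M (inhabited_witness uv).

Definition rep_iso (k : fieldType) (Q : quiver) (M N : rep k Q) : Prop :=
  exists f : forall v : Q, 'Hom(M v, N v),
    (forall v, bijective (f v)) /\
    (forall a : arrow Q,
       (f (tgt a) \o rmap M a)%VF = (rmap N a \o f (src a))%VF).

Definition zero_rep (k : fieldType) (Q : quiver) : rep k Q :=
  @Rep k Q (fun=> 'rV[k]_0 : vectType k) (fun=> 0%R).

Definition dsum_rep (k : fieldType) (Q : quiver) (M N : rep k Q) : rep k Q :=
  @Rep k Q (fun v => (M v * N v)%type : vectType k)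
    (fun a => linfun (fun x : M (src a) * N (src a) =>
                        (rmap M a x.1, rmap N a x.2))).

Definition is_zero_rep (k : fieldType) (Q : quiver) (M : rep k Q) : Prop :=
  forall v : Q, \dim (fullv : {vspace M v}) = 0.

Definition indecomposable (k : fieldType) (Q : quiver) (M : rep k Q) : Prop :=
  ~ is_zero_rep M /\
  forall A B : rep k Q, rep_iso M (dsum_rep A B) ->
    is_zero_rep A \/ is_zero_rep B.

Definition is_decomposition (k : fieldType) (Q : quiver) (N : rep k Q)
    (s : seq (rep k Q)) : Prop :=
  all (fun L => `[< indecomposable L >]) s /\
  rep_iso N (foldr (@dsum_rep k Q) (zero_rep k Q) s).

Definition is_multiplicity (k : fieldType) (Q : quiver) (N L : rep k Q)
    (m : nat) : Prop :=
  exists2 s, is_decomposition N s & m = count (fun L' => `[< rep_iso L' L >]) s.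

(* By Krull-Schmidt exactly one m satisfies is_multiplicity N L m, so neither
   the choice of m nor the default value matters. *)
Definition multiplicity (k : fieldType) (Q : quiver) (N L : rep k Q) : nat :=
  if pselect (exists m, is_multiplicity N L m) is left ex_m
  then projT1 (cid ex_m) else 0.

(* The space at u is k^1 if u is in I and k^0 otherwise; between two vertices
   of I the matrix const_mx 1 is the 1 x 1 identity, otherwise it is empty. *)
Definition interval_rep (k : fieldType) (Q : quiver) (I : {set Q}) : rep k Q :=
  @Rep k Q (fun u => 'rV[k]_(u \in I) : vectType k)
    (fun a => linfun (fun x : 'rV[k]_(src a \in I) =>
        (x *m (const_mx 1%R : 'M[k]_(src a \in I, tgt a \in I)))%R)).

Record course (Q : quiver) := Course {
  cquiver : quiver;
  cmap : cquiver -> Q;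
  course_connected : qconnected cquiver;
  course_acyclic : qacyclic cquiver;
  course_path : forall a : arrow cquiver,
    inhabited (qpath (cmap (src a)) (cmap (tgt a))) }.

Definition essential_course (Q : quiver) (I : {set Q}) (C : course Q) : bool :=
  (essential_vertices I \subset [set cmap c | c : cquiver C]) &&
  ([set cmap c | c : cquiver C] \subset I).

Definition essential_assignment (Q : quiver) (xi : qinterval Q -> course Q) :
    Prop :=
  forall I : qinterval Q, essential_course I (xi I).

Definition tour (k : fieldType) (Q : quiver) (C : course Q) (M : rep k Q) :
    rep k (cquiver C) :=
  @Rep k (cquiver C) (fun c => M (cmap c))
    (fun a => transition M (course_path a)).

Definition compressed_multiplicity (k : fieldType) (Q : quiver)
    (xi : qinterval Q -> course Q) (M : rep k Q) (I : qinterval Q) : nat :=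
  multiplicity (tour (xi I) M) (tour (xi I) (interval_rep k I)).

Section Moebius.
Variables (Q : quiver) (c : qinterval Q -> int).
Local Open Scope ring_scope.

Lemma sum_supersets (d : qinterval Q -> int) (I : qinterval Q) :
  \sum_(J : qinterval Q | I \subset J) d J =
  d I + \sum_(J : qinterval Q | I \proper J) d J.
Proof.
rewrite (bigD1 I) //=; congr (_ + _); apply: eq_bigl => J.
by rewrite properEneq andbC eq_sym.
Qed.

Lemma moebius_inversion : exists d : qinterval Q -> int,
  forall I, c I = \sum_(J : qinterval Q | I \subset J) d J.
Proof.
have [d Hd] : exists d : qinterval Q -> int, forall I : qinterval Q, (#|~: I| < #|Q|.+1)%N ->
    c I = \sum_(J : qinterval Q | I \subset J) d J.
  elim: (#|Q|.+1) => [|m [d Hd]]; first by exists (fun=> 0).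
  pose d' (I : qinterval Q) := if (#|~: I| < m)%N then d I
    else c I - \sum_(J : qinterval Q | I \proper J) d J.
  have prop_lt (I J : qinterval Q) :
      (#|~: I| < m.+1)%N -> I \proper J -> (#|~: J| < m)%N.
    move=> ltIm pIJ; apply: leq_trans (ltIm : (_ <= m)%N).
    by apply: proper_card; rewrite properC.
  exists d' => I ltIm; rewrite sum_supersets.
  have -> : \sum_(J : qinterval Q | I \proper J) d' J =
            \sum_(J : qinterval Q | I \proper J) d J.
    by apply: eq_bigr => J pIJ; rewrite /d' (prop_lt I J).
  rewrite /d'; case: ifP => [lt|_]; last by rewrite subrK.
  by rewrite Hd // sum_supersets.
by exists d => I; apply: Hd; rewrite ltnS max_card.
Qed.

Lemma moebius_unique (d d' : qinterval Q -> int) :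
  (forall I, c I = \sum_(J : qinterval Q | I \subset J) d J) ->
  (forall I, c I = \sum_(J : qinterval Q | I \subset J) d' J) -> d =1 d'.
Proof.
move=> Hd Hd' I; have [m] := ubnP #|~: I|; elim: m I => // m IHm I ltIm.
have := Hd I; rewrite Hd' !sum_supersets => E.
have E2 : \sum_(J : qinterval Q | I \proper J) d' J =
          \sum_(J : qinterval Q | I \proper J) d J.
  apply: eq_bigr => J pIJ; apply/esym/IHm.
  by apply: leq_trans (ltIm : (_ <= m)%N); apply: proper_card; rewrite properC.
by move: E; rewrite E2 => /addIr.
Qed.

End Moebius.

Definition interval_approx (k : fieldType) (Q : quiver)
    (xi : qinterval Q -> course Q) (M : rep k Q) : qinterval Q -> int :=
  projT1 (cid (moebius_inversion
    (fun I => Posz (compressed_multiplicity xi M I)))).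

Definition rel_quiver (T : finType) (e : rel T) : quiver :=
  @Quiver T {uv : T * T | e uv.1 uv.2}
    (fun a => (val a).1) (fun a => (val a).2).

Definition A_rel (n : nat) : rel 'I_n := [rel i j : 'I_n | i.+1 == j :> nat].

(* Columns are indexed from 0; row false is the lower row (row 1) and row true
   the upper row (row 2). *)
Definition CL_rel (n : nat) : rel ('I_n * bool) :=
  [rel u v : 'I_n * bool |
       ((u.2 == v.2) && A_rel u.1 v.1)
    || [&& u.1 == v.1, ~~ u.2 & v.2]].

Definition A_quiver (n : nat) : quiver := rel_quiver (@A_rel n).
Definition CL (n : nat) : quiver := rel_quiver (@CL_rel n).

Notation lower_row := false (only parsing).
Notation upper_row := true (only parsing).

Lemma CL_row_arrow (n : nat) (j : bool) (a : arrow (A_quiver n)) :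
  CL_rel ((val a).1, j) ((val a).2, j).
Proof. by rewrite /CL_rel /= eqxx (valP a). Qed.

Definition row_arrow (n : nat) (j : bool) (a : arrow (A_quiver n)) :
    arrow (CL n) :=
  exist _ (((val a).1, j), ((val a).2, j)) (CL_row_arrow j a).

Definition row_rep (k : fieldType) (n : nat) (M : rep k (CL n)) (j : bool) :
    rep k (A_quiver n) :=
  @Rep k (A_quiver n) (fun i => M (i, j)) (fun a => rmap M (row_arrow j a)).

Definition A_segment (n : nat) (b d : 'I_n) : {set A_quiver n} :=
  [set i : 'I_n | b <= i <= d].

Definition CL_segment (n : nat) (j : bool) (b d : 'I_n) : {set CL n} :=
  [set u : 'I_n * bool | (b <= u.1 <= d) && (u.2 == j)].

Section LadderIntervals.
Variable n : nat.

Let le_CL (u v : CL n) : bool := (u.1 <= v.1) && (u.2 ==> v.2).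

Lemma le_CL_trans (u v w : CL n) : le_CL u v -> le_CL v w -> le_CL u w.
Proof.
case/andP=> le1 le2 /andP[le3 le4]; rewrite /le_CL (leq_trans le1 le3) /=.
by move: le2 le4; case: u.2; case: v.2.
Qed.

Lemma CL_path_le (u v : CL n) (p : qpath u v) : le_CL u v.
Proof.
elim: p => [w|a w p IHp]; first by rewrite /le_CL leqnn implybb.
apply: le_CL_trans IHp; have := valP a; rewrite /CL_rel /le_CL /=.
case/orP => [/andP[/eqP-> /eqP <-]|/and3P[/eqP-> /negPf-> _]].
  by rewrite implybb leqnSn.
by rewrite leqnn.
Qed.

Lemma CL_path_vertices (u v : CL n) (p : qpath u v) (w : CL n) :
  w \in qvertices p -> le_CL u w && le_CL w v.
Proof.
elim: p => [x|a x p IHp] /=.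
  by rewrite inE => /eqP->; rewrite /le_CL leqnn implybb.
rewrite inE => /predU1P[->|/IHp /andP[le1 ->]].
  by rewrite (CL_path_le (qcons p)) /le_CL leqnn implybb.
by rewrite andbT (le_CL_trans (CL_path_le (qcons (qnil (tgt a)))) le1).
Qed.

Lemma CL_arrow (u v : CL n) : CL_rel u v ->
  exists a : arrow (CL n), src a = u /\ tgt a = v.
Proof.
move=> uv; have H : CL_rel (u, v).1 (u, v).2 by [].
by exists (exist _ (u, v) H).
Qed.

Lemma CL_pathP (u v : CL n) : le_CL u v -> inhabited (qpath u v).
Proof.
case: u v => [i j] [i' j'] /andP[/= le_i le_j].
have [m] := ubnP (i' - i); elim: m i le_i => // m IHm i le_i lt_m.
move: le_i; rewrite leq_eqVlt => /orP[/eqP/val_inj E|lt_i].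
  case: j j' le_j {IHm} => [] [] // _; rewrite E; try by constructor; constructor.
  have [|a [Ea Eb]] := @CL_arrow (i', false) (i', true).
    by rewrite /CL_rel /= eqxx.
  by rewrite -Ea -Eb; constructor; apply: qcons; apply: qnil.
have lt_Si : i.+1 < n by apply: leq_ltn_trans (ltn_ord i').
have [//|/=|p] := IHm (Ordinal lt_Si).
  by rewrite subnS -ltnS prednK ?subn_gt0.
have [|a [Ea Eb]] := @CL_arrow (i, j) (Ordinal lt_Si, j).
  by rewrite /CL_rel /A_rel /= !eqxx.
by constructor; move: p; rewrite -Ea -Eb; apply: qcons.
Qed.

Lemma qpath_cat (Q : quiver) (u v w : Q) (p : qpath u v) (q : qpath v w) :
  exists r : qpath u w, v \in qvertices r.
Proof.
elim: p q => [x|a x p IHp] q.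
  by exists q; case: q => *; rewrite inE eqxx.
by have [r Hr] := IHp q; exists (qcons r); rewrite inE Hr orbT.
Qed.

Lemma CL_convexP (I : {set CL n}) :
  qconvex I <-> forall u v w : CL n, u \in I -> v \in I ->
    le_CL u w -> le_CL w v -> w \in I.
Proof.
split=> [cvxI u v w uI vI /CL_pathP[p] /CL_pathP[q]|H u v p uI vI w].
  by have [r] := qpath_cat p q; apply: cvxI.
by case/CL_path_vertices/andP; apply: H.
Qed.

Lemma adjacent_in_sym (Q : quiver) (I : {set Q}) :
  connect_sym (adjacent_in I).
Proof.
apply: sym_connect_sym => u v; rewrite /adjacent_in /= andbCA.
by congr [&& _, _ & _]; apply: eq_existsb => a; rewrite orbC.
Qed.

Lemma CL_adjacent (I : {set CL n}) (u v : CL n) :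
  u \in I -> v \in I -> CL_rel u v -> connect (adjacent_in I) u v.
Proof.
move=> uI vI /CL_arrow[a [Ea Eb]]; apply: connect1.
by apply/and3P; split=> //; apply/existsP; exists a; rewrite Ea Eb !eqxx.
Qed.

Lemma CL_segment_connect (I : {set CL n}) (j : bool) (b d i : 'I_n) :
  CL_segment j b d \subset I -> b <= i <= d ->
  connect (adjacent_in I) (b, j) (i, j).
Proof.
move=> /subsetP sI; have [m] := ubnP i; elim: m i => // m IHm i lt_m.
case/andP; rewrite leq_eqVlt => /orP[/eqP/val_inj-> //|lt_bi le_id].
have lt_i : i.-1 < n by apply: leq_ltn_trans (leq_pred _) (ltn_ord i).
have Ei : i.-1.+1 = i by rewrite prednK // (leq_ltn_trans _ lt_bi).
have Hi : b <= Ordinal lt_i <= d.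
  by rewrite /= -ltnS Ei lt_bi (leq_trans (leq_pred _)).
apply: connect_trans (IHm (Ordinal lt_i) _ Hi) _; first by rewrite /= Ei.
apply: CL_adjacent; [apply: sI|apply: sI|].
- by rewrite inE /= Hi eqxx.
- by rewrite inE /= (ltnW lt_bi) le_id eqxx.
- by rewrite /CL_rel /A_rel /= Ei !eqxx.
Qed.

Lemma CL_segment_interval (j : bool) (b d : 'I_n) : b <= d ->
  is_qinterval (CL_segment j b d).
Proof.
move=> le_bd; split.
- by apply/set0Pn; exists (b, j); rewrite inE /= leqnn le_bd eqxx.
- move=> [i ji] [i' ji']; rewrite !inE /=.
  move=> /andP[Hi /eqP->] /andP[Hi' /eqP->].
  apply: connect_trans (CL_segment_connect (subxx _) Hi').
  by rewrite adjacent_in_sym (CL_segment_connect (subxx _)).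
- apply/CL_convexP => [] [i ji] [i' ji'] [i'' ji'']; rewrite !inE /le_CL /=.
  move=> /andP[/andP[H1 H2] /eqP->] /andP[/andP[H3 H4] /eqP->].
  move=> /andP[H5 H6] /andP[H7 H8].
  rewrite (leq_trans H1 H5) (leq_trans H7 H4) /=.
  by case: j ji'' H6 H8 => [] [].
Qed.

Lemma CL_two_rows_interval (b1 d1 b2 d2 : 'I_n) :
  b2 <= b1 -> b1 <= d2 -> d2 <= d1 ->
  is_qinterval (CL_segment lower_row b1 d1 :|: CL_segment upper_row b2 d2).
Proof.
move=> le1 le2 le3; set I := _ :|: _; split.
- by apply/set0Pn; exists (b1, lower_row); rewrite !inE /= leqnn (leq_trans le2).
- suff H u : u \in I -> connect (adjacent_in I) (b1, upper_row) u.
    move=> u v uI vI; apply: connect_trans (H v vI).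
    by rewrite adjacent_in_sym H.
  have Hb : connect (adjacent_in I) (b2, upper_row) (b1, upper_row).
    by apply: (@CL_segment_connect _ _ _ d2); rewrite ?subsetUr ?le1.
  case: u => i [] /=; rewrite !inE /= !(eqxx, andbT, andbF, orbF) /= => Hi.
    rewrite adjacent_in_sym in Hb; apply: connect_trans Hb _.
    by apply: (@CL_segment_connect _ _ _ d2); rewrite ?subsetUr.
  have Hv : connect (adjacent_in I) (b1, lower_row) (b1, upper_row).
    apply: CL_adjacent; last by rewrite /CL_rel /= !eqxx ?orbT.
      by rewrite !inE /= leqnn (leq_trans le2).
    by rewrite !inE /= le1 le2 orbT.
  rewrite adjacent_in_sym in Hv; apply: connect_trans Hv _.
  by apply: (@CL_segment_connect _ _ _ d1); rewrite ?subsetUl.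
- apply/CL_convexP => [] [i ji] [i' ji'] [i'' ji'']; rewrite !inE /le_CL /=.
  move=> H1 H2 /andP[H3 H4] /andP[H5 H6].
  have H7 : if ji then b2 <= i else b1 <= i.
    by case: ji H1 {H4}; rewrite /= !(andbT, andbF, orbF) => /andP[].
  have H8 : if ji' then i' <= d2 else i' <= d1.
    by case: ji' H2 {H6}; rewrite /= !(andbT, andbF, orbF) => /andP[].
  have [H9 H10] : (if ji then b2 <= i'' else b1 <= i'') /\
                  (if ji' then i'' <= d2 else i'' <= d1).
    by split; [case: (ji) H7 | case: (ji') H8] => H;
      rewrite ?(leq_trans H H3) ?(leq_trans H5 H).
  move: H4 H6 H9 H10; rewrite {H1 H2 H7 H8}.
  case: ji ji' ji'' => [] [] [] //= _ _ H7 H8;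
    rewrite !(andbT, andbF, orbF) /= ?H7 ?H8 ?(leq_trans le1 H7) //.
  by rewrite (leq_trans H8 le3).
Qed.

Definition row_interval (j : bool) (b d : 'I_n) (le_bd : b <= d) :
    qinterval (CL n) :=
  QInterval (asboolT (CL_segment_interval j le_bd)).

(* The families I_1, I_2 (for j = lower_row, upper_row) and I_{2/1}. *)
Definition row_intervals (j : bool) : {set qinterval (CL n)} :=
  [set I : qinterval (CL n) | [exists b : 'I_n, exists d : 'I_n,
     (b <= d) && (qinterval_set I == CL_segment j b d)]].

Definition two_row_intervals : {set qinterval (CL n)} :=
  [set I : qinterval (CL n) |
     [exists b1 : 'I_n, exists d1 : 'I_n, exists b2 : 'I_n, exists d2 : 'I_n,
       [&& b2 <= b1, b1 <= d2, d2 <= d1 &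
         qinterval_set I == CL_segment lower_row b1 d1
                        :|: CL_segment upper_row b2 d2]]].

Lemma CL_row_part (I : {set CL n}) (j : bool) (i0 : 'I_n) :
  qconvex I -> (i0, j) \in I ->
  exists b d : 'I_n, b <= d /\ forall i, ((i, j) \in I) = (b <= i <= d).
Proof.
move=> /CL_convexP cvxI i0I; pose P (i : 'I_n) := (i, j) \in I.
have [b Pb minb] := @arg_minnP _ i0 P val i0I.
have [d Pd maxd] := @arg_maxnP _ i0 P val i0I.
exists b, d; split=> [|i]; first exact: minb.
apply/idP/idP => [Pi|/andP[le1 le2]]; first by apply/andP; split; [exact: minb | exact: maxd].
by apply: (cvxI (b, j) (d, j)) => //; rewrite /le_CL /= implybb ?le1 ?le2.
Qed.

Lemma adjacent_rows_split (I : {set CL n}) (u v : CL n) :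
  (forall i, ~~ (((i, false) \in I) && ((i, true) \in I))) ->
  adjacent_in I u v -> u.2 = v.2.
Proof.
move=> HI /and3P[uI vI /existsP[a Ha]].
have: CL_rel u v \/ CL_rel v u.
  by have := valP a; case/orP: Ha => /andP[/eqP<- /eqP<-]; [left|right].
have H (x y : CL n) : x \in I -> y \in I -> CL_rel x y -> x.2 = y.2.
  case: x y => [i j] [i' j'] xI yI /orP[/andP[/eqP//]|].
  case/and3P=> /= /eqP Ei; case: j j' Ei xI yI => [] [] //= <- H1 H2 _ _.
  by have := HI i; rewrite H1 H2.
by case=> E; [exact: H E | exact: esym (H _ _ vI uI E)].
Qed.

Lemma CL_intervalsE :
  [set: qinterval (CL n)] =
  row_intervals lower_row :|: row_intervals upper_row :|: two_row_intervals.
Proof.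
apply/eqP; rewrite eq_sym eqEsubset subsetT; apply/subsetP => I _.
have /asboolP[/set0Pn[u0 u0I] conI cvxI] := qintervalP I.
have row_only j : (forall u, u \in qinterval_set I -> u.2 = j) ->
    I \in row_intervals j.
  move=> Hj; have Eu0 := Hj _ u0I; case: u0 Eu0 u0I => [i0 j0] /= -> u0I.
  have [b [d [le_bd E]]] := CL_row_part cvxI u0I.
  rewrite inE; apply/existsP; exists b; apply/existsP; exists d; rewrite le_bd.
  apply/eqP/setP => -[i j']; rewrite [RHS]inE /=; case: eqP => [->|nj].
    by rewrite E andbT.
  by rewrite andbF; apply/negP => /Hj.
rewrite !in_setU.
have [/forallP all_lower|] :=
    boolP [forall u, (u \in qinterval_set I) ==> ~~ u.2].
  rewrite (row_only lower_row) // => u uI.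
  exact: negbTE (implyP (all_lower u) uI).
have [/forallP all_upper _|] :=
    boolP [forall u, (u \in qinterval_set I) ==> u.2].
  rewrite (row_only upper_row) ?orbT // => u uI.
  exact: (implyP (all_upper u) uI).
rewrite !negb_forall => /existsP[[i1 []]]; rewrite negb_imply ?andbF //= andbT.
move=> u1I /existsP[[i2 []]]; rewrite negb_imply ?andbF //= andbT => u2I.
have [b1 [d1 [le1 E1]]] := CL_row_part cvxI u1I.
have [b2 [d2 [le2 E2]]] := CL_row_part cvxI u2I.
suff [i] : exists i, ((i, false) \in qinterval_set I)
                                 && ((i, true) \in qinterval_set I).
  move=> /andP[iI1 iI2]; apply/orP; right; rewrite inE.
  have le_CLP u v w := (CL_convexP _).1 cvxI u v w.
  have le_b : b2 <= b1.
    case: (leqP b2 b1) => // lt_b.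
    have : (b1, true) \in qinterval_set I.
      apply: (le_CLP (b1, false) (b2, true)); rewrite ?E1 ?E2 ?leqnn ?le1 ?le2 //.
        by rewrite /le_CL /= leqnn.
      by rewrite /le_CL /= ltnW.
    by rewrite E2 leqNgt lt_b.
  have le_d : d2 <= d1.
    case: (leqP d2 d1) => // lt_d.
    have : (d2, false) \in qinterval_set I.
      apply: (le_CLP (d1, false) (d2, true)); rewrite ?E1 ?E2 ?leqnn ?le1 ?le2 //.
        by rewrite /le_CL /= ltnW.
      by rewrite /le_CL /= leqnn.
    by rewrite E1 andbC leqNgt lt_d.
  have le_bd : b1 <= d2.
    move: iI1 iI2; rewrite E1 E2 => /andP[H1 _] /andP[_ H2].
    exact: leq_trans H1 H2.
  apply/existsP; exists b1; apply/existsP; exists d1.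
  apply/existsP; exists b2; apply/existsP; exists d2.
  apply/and4P; split=> //; apply/eqP/setP => -[i' []]; rewrite !inE /=.
    by rewrite E2 andbF andbT.
  by rewrite E1 andbF andbT orbF.
have [/existsP //|] := boolP [exists i, ((i, false) \in qinterval_set I)
                                 && ((i, true) \in qinterval_set I)].
rewrite negb_exists => /forallP HI.
have cl : closed (adjacent_in (qinterval_set I)) [pred u : CL n | u.2].
  by move=> u v /(adjacent_rows_split HI); rewrite !inE => ->.
by have := closed_connect cl (conI _ _ u1I u2I).
Qed.
End LadderIntervals.

(* J ranges over the members [b2,d2]_2 |_| [b1,d1]_1 of I_{2/1} with the given
   interval I as lower (resp. upper) row; these correspond bijectively to the
   pairs of endpoints of the other row. *)
Definition tilde (n : nat) (delta : qinterval (CL n) -> int)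
    (I : qinterval (CL n)) : int :=
  if I \in row_intervals n lower_row then
    (delta I + \sum_(J in two_row_intervals n |
        [exists b2 : 'I_n, exists d2 : 'I_n,
           qinterval_set J == CL_segment upper_row b2 d2 :|: I]) delta J)%R
  else if I \in row_intervals n upper_row then
    (delta I + \sum_(J in two_row_intervals n |
        [exists b1 : 'I_n, exists d1 : 'I_n,
           qinterval_set J == I :|: CL_segment lower_row b1 d1]) delta J)%R
  else delta I.

(* Main.v *)
Require Import Defs.
From HB Require Import structures.
From mathcomp Require Import all_boot all_order all_algebra.
From mathcomp Require Import boolp.

Set Implicit Arguments.
Unset Strict Implicit.
Unset Printing Implicit Defensive.

Import GRing.Theory.
(** The auxiliary function on one row undoes the interval approximation there.
    For a segment S = [b,d] of row j, the value of tilde delta at S is the sum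
    of delta over all intervals J whose part in row j is exactly S.  By
    convexity, that part equals S iff J contains both ends of S but neither the
    vertex before b nor the vertex after d, so inclusion-exclusion expresses this
    sum through the sums of delta over all J containing a given segment, which are
    compressed multiplicities of segments by the definition of delta
    ([row_part_segment], [tilde_row], [row_inclusion_exclusion]).  Two rank
    computations then give both sides the same value, where r(x,y) denotes the
    rank of M from column x to column y in row j:

    - the compressed multiplicity of [b,d] is r(b,d), for every essential
      course ([tour_multiplicity]);
    - the multiplicity of V_[b,d] in the row is
      r(b,d) - r(b-1,d) - r(b,d+1) + r(b-1,d+1), where ranks that involve a
      column outside the ladder count as 0 ([row_multiplicity]).

    Both are instances of one principle.  Let I be a nonempty connected set of
    vertices of a quiver, and pair homomorphisms V_I -> N with homomorphisms
    N -> V_I by composing them to an endomorphism of V_I, that is, a scalar.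
    The rank of this pairing is additive on direct sums, is 1 on V_I, and is 0
    on an indecomposable not isomorphic to V_I, because a nonzero value splits
    V_I off as a direct summand.  Hence it is the multiplicity of V_I in N,
    whatever decomposition is used to count it ([multiplicity_pairing_rank]).

    The pairing is then computed when N is pulled back from a commutative
    representation M along a map F of quiver vertices.  If c0 and c1 in I map to
    the first and last vertex of F(I), then commutativity and connectedness make
    the value of any section at c1 the image under M of its value at c0, so the
    pairing is induced by f = M(F c0 -> F c1), restricted by the arrows that
    enter or leave I ([pullback_rank_formula]).  A tour has no such arrows and
    the rank is that of f; a segment of a row has at most one of each, which
    yields the alternating sum. *)

Local Open Scope ring_scope.

(** * Linear algebra *)

Lemma linfun_linear (k : fieldType) (U V : vectType k) (f : U -> V) :
  linear f -> linfun f =1 f.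
Proof.
move=> fL; pose F : {linear U -> V} :=
  HB.pack f (GRing.isLinear.Build k U V *:%R f fL).
by move=> x; rewrite (lfunE F).
Qed.

Lemma hom_of (k : fieldType) (U V : vectType k) (f : U -> V) :
  linear f -> exists h : 'Hom(U, V), h =1 f.
Proof. by move=> fL; exists (linfun f); apply: linfun_linear. Qed.

Lemma dim_bijective (k : fieldType) (A B : vectType k) (f : 'Hom(A, B)) :
  bijective f -> \dim (fullv : {vspace A}) = \dim (fullv : {vspace B}).
Proof.
move=> [g fg gf]; have := limg_ker_dim f fullv.
have /eqP -> : lker f == 0%VS by apply/lker0P/can_inj.
rewrite capv0 dimv0 add0n => <-; congr (\dim _).
by apply/vspaceP => x; rewrite memvf -[x]gf memv_img ?memvf.
Qed.

Lemma functional_separates (k : fieldType) (B : vectType k)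
    (U : {vspace B}) (w : B) :
  (forall psi : 'Hom(B, k^o), (forall u, u \in U -> psi u = 0) -> psi w = 0) ->
  w \in U.
Proof.
move=> H; suff : w - projv U w == 0.
  by rewrite subr_eq0 => /eqP->; exact: memv_proj.
(* The coordinates of x - projv U x are linear forms that vanish on U. *)
rewrite [w - _](coord_vbasis (memvf _)) big1 // => j _.
have [|psi Hpsi] := @hom_of k B k^o
    (fun x => coord (vbasis fullv) j (x - projv U x)).
  by move=> a x y; rewrite linearP opprD addrACA -scalerBr linearP.
rewrite -Hpsi H ?scale0r // => u uU.
by rewrite Hpsi projv_id // subrr linear0.
Qed.

(** The families x and psi witness that the pairing (a, p) |-> p (f a), for a in
    the kernel of h f and p vanishing on the image of f g, has rank #|T|.  That
    rank is the codimension of im (f g) :&: ker h in im f :&: ker h: the map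
    w |-> (psi_i w)_i sends the larger space onto k^T with the smaller one as
    kernel. *)
Lemma induced_pairing_rank (k : fieldType) (X A B Y : vectType k)
    (g : 'Hom(X, A)) (f : 'Hom(A, B)) (h : 'Hom(B, Y))
    (T : finType) (x : T -> A) (psi : T -> 'Hom(B, k^o)) :
  (forall i, h (f (x i)) = 0) ->
  (forall i z, psi i (f (g z)) = 0) ->
  (forall i j, psi i (f (x j)) = (i == j)%:R) ->
  (forall (a : A) (p : 'Hom(B, k^o)), h (f a) = 0 ->
     (forall z, p (f (g z)) = 0) ->
     p (f a) = \sum_i p (f (x i)) * psi i (f a)) ->
  (#|T| + \dim (limg (h \o f)) + \dim (limg (f \o g)) =
   \dim (limg f) + \dim (limg (h \o f \o g)))%N.
Proof.
move=> hx psig psix full.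
pose W := (limg f :&: lker h)%VS; pose W' := (limg (f \o g) :&: lker h)%VS.
have dimW : (\dim W + \dim (limg (h \o f)) = \dim (limg f))%N.
  by rewrite limg_comp limg_ker_dim.
have dimW' : (\dim W' + \dim (limg (h \o f \o g)) = \dim (limg (f \o g)))%N.
  by rewrite -comp_lfunA (limg_comp (f \o g)) limg_ker_dim.
have [|Psi PsiE] := @hom_of k B 'rV[k]_#|T|
    (fun w => \row_i psi (enum_val i) w).
  by move=> a u v; apply/rowP => i; rewrite !mxE linearP.
have kerPsi : (W :&: lker Psi)%VS = W'.
  apply/vspaceP => w; rewrite !memv_cap !memv_ker; apply/idP/idP.
    case/andP=> /andP[/memv_imgP[a _ ->]] /eqP hfa /eqP Pfa.
    rewrite hfa eqxx andbT; apply: functional_separates => p Hp.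
    have Pi i : psi i (f a) = 0.
      move: Pfa; rewrite PsiE => /rowP/(_ (enum_rank i)).
      by rewrite !mxE enum_rankK.
    rewrite full // => [|z]; first by apply: big1 => i _; rewrite Pi mulr0.
    by apply: Hp; rewrite -comp_lfunE memv_img ?memvf.
  case/andP=> /memv_imgP[a _ ->] ->; rewrite comp_lfunE memv_img ?memvf //=.
  by apply/eqP; rewrite PsiE; apply/rowP => i; rewrite !mxE psig.
have imPsi : (Psi @: W)%VS = fullv.
  apply/vspaceP => v; rewrite memvf.
  rewrite (_ : v = Psi (\sum_i v 0 (enum_rank i) *: f (x i))).
    apply: memv_img; apply: memv_suml => i _; apply: memvZ.
    by rewrite memv_cap memv_img ?memvf // memv_ker hx eqxx.
  apply/rowP => j; rewrite PsiE mxE linear_sum (bigD1 (enum_val j)) //=.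
  rewrite linearZ /= psix eqxx enum_valK big1 ?addr0.
    by rewrite /GRing.scale /= mulr1.
  by move=> i ni; rewrite linearZ /= psix eq_sym (negPf ni) scaler0.
have := limg_ker_dim Psi W; rewrite kerPsi imPsi dimvf /dim /= mul1n => E.
rewrite -dimW -dimW' -E addnAC addnA [in RHS]addnAC.
by rewrite (addnC (\dim W')) -!addnA.
Qed.

(** * Direct sums and decompositions of representations *)

Section Decompositions.
Variables (k : fieldType) (Q : quiver).
Implicit Types A B L M N : rep k Q.

Lemma dsum_rmapE M N (a : arrow Q) (x : dsum_rep M N (src a)) :
  rmap (dsum_rep M N) a x = (rmap M a x.1, rmap N a x.2).
Proof.
by rewrite [LHS]linfun_linear // => c u v; congr pair; apply: linearP.
Qed.

Lemma rep_iso_intro M N (f : forall v, M v -> N v) :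
  (forall v, linear (f v)) -> (forall v, bijective (f v)) ->
  (forall a x, f (tgt a) (rmap M a x) = rmap N a (f (src a) x)) ->
  rep_iso M N.
Proof.
move=> fL fB fC; exists (fun v => linfun (f v)); split=> [v|a].
  by apply: (eq_bij (fB v)) => x; rewrite (linfun_linear (fL v)).
by apply/lfunP => x; rewrite !comp_lfunE !(linfun_linear (fL _)) fC.
Qed.

Lemma rep_iso_elim M N : rep_iso M N ->
  exists (f : forall v, 'Hom(M v, N v)) (g : forall v, 'Hom(N v, M v)),
  [/\ forall v, cancel (f v) (g v), forall v, cancel (g v) (f v),
      forall a x, f (tgt a) (rmap M a x) = rmap N a (f (src a) x) &
      forall a y, g (tgt a) (rmap N a y) = rmap M a (g (src a) y)].
Proof.
move=> [f [fB fC]]; exists f; exists (fun v => (f v)^-1%VF).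
have fK v : cancel (f v) (f v)^-1%VF.
  by apply/lker0_lfunK/lker0P/bij_inj.
have gK v : cancel (f v)^-1%VF (f v).
  by have [h _ hK] := fB v => y; rewrite -[y]hK fK.
have fE a x : f (tgt a) (rmap M a x) = rmap N a (f (src a) x).
  by have := congr1 (fun h : 'Hom(_, _) => h x) (fC a); rewrite !comp_lfunE.
split=> // a y.
by apply: (can_inj (fK (tgt a))); rewrite gK fE gK.
Qed.

Lemma rep_iso_refl M : rep_iso M M.
Proof.
by apply: (@rep_iso_intro M M (fun v => id)) => // v; exists id.
Qed.

Lemma rep_iso_sym M N : rep_iso M N -> rep_iso N M.
Proof.
case/rep_iso_elim => f [g [fK gK _ gC]].
apply: (@rep_iso_intro N M (fun v => g v)) => // v; last by exists (f v).
by move=> c x y; rewrite linearP.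
Qed.

Lemma rep_iso_trans M N L : rep_iso M N -> rep_iso N L -> rep_iso M L.
Proof.
case/rep_iso_elim => f [g [fK gK fC _]].
case/rep_iso_elim => f' [g' [fK' gK' fC' _]].
apply: (@rep_iso_intro M L (fun v => f' v \o f v)) => [v|v|a x] /=.
- by move=> c x y; rewrite /= !linearP.
- exists (g v \o g' v).
    exact: can_comp (fK' v) (fK v).
  exact: can_comp (gK v) (gK' v).
- by rewrite fC fC'.
Qed.

Lemma dsum_iso M M' N N' : rep_iso M M' -> rep_iso N N' ->
  rep_iso (dsum_rep M N) (dsum_rep M' N').
Proof.
case/rep_iso_elim => f [g [fK gK fC _]].
case/rep_iso_elim => f' [g' [fK' gK' fC' _]].
apply: (@rep_iso_intro (dsum_rep M N) (dsum_rep M' N')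
  (fun v x => (f v x.1, f' v x.2))) => [v|v|a x].
- by move=> c x y; congr pair; apply: linearP.
- by exists (fun x => (g v x.1, g' v x.2)) => -[x y] /=;
    rewrite ?(fK, fK', gK, gK').
- by rewrite !dsum_rmapE /= fC fC'.
Qed.

Lemma dsum_assoc A B N :
  rep_iso (dsum_rep (dsum_rep A B) N) (dsum_rep A (dsum_rep B N)).
Proof.
apply: (@rep_iso_intro (dsum_rep (dsum_rep A B) N) (dsum_rep A (dsum_rep B N))
  (fun v x => (x.1.1, (x.1.2, x.2)))) => [v|v|a x].
- by move=> c [[? ?] ?] [[? ?] ?].
- by exists (fun x => ((x.1, x.2.1), x.2.2)) => [[[? ?] ?]|[? [? ?]]].
- by rewrite !dsum_rmapE.
Qed.

Lemma zero_rep_eq0 v (x : zero_rep k Q v) : x = 0.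
Proof. exact: thinmx0. Qed.

Lemma dsum_zero_l N : rep_iso N (dsum_rep (zero_rep k Q) N).
Proof.
apply: (@rep_iso_intro N (dsum_rep (zero_rep k Q) N)
  (fun v x => (0, x))) => [v|v|a x].
- by move=> c x y; congr pair; rewrite /= scaler0 addr0.
- by exists snd => // -[x y]; rewrite [x]zero_rep_eq0.
- by rewrite dsum_rmapE /= linear0.
Qed.

Lemma dsum_zero_r N : rep_iso N (dsum_rep N (zero_rep k Q)).
Proof.
apply: (@rep_iso_intro N (dsum_rep N (zero_rep k Q))
  (fun v x => (x, 0))) => [v|v|a x].
- by move=> c x y; congr pair; rewrite /= scaler0 addr0.
- by exists fst => // -[x y]; rewrite [y]zero_rep_eq0.
- by rewrite dsum_rmapE /= linear0.
Qed.

Lemma dsum_cat (s1 s2 : seq (rep k Q)) :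
  let S := foldr (@dsum_rep k Q) (zero_rep k Q) in
  rep_iso (dsum_rep (S s1) (S s2)) (S (s1 ++ s2)).
Proof.
move=> S; elim: s1 => [|A s1 IH] /=.
  exact/rep_iso_sym/dsum_zero_l.
apply: rep_iso_trans (dsum_assoc _ _ _) _.
exact: dsum_iso (rep_iso_refl _) IH.
Qed.

Lemma rep_iso_dim M N v : rep_iso M N ->
  \dim (fullv : {vspace M v}) = \dim (fullv : {vspace N v}).
Proof. by case=> f [fB _]; apply: dim_bijective (fB v). Qed.

Lemma dsum_dim A B v : \dim (fullv : {vspace dsum_rep A B v}) =
  (\dim (fullv : {vspace A v}) + \dim (fullv : {vspace B v}))%N.
Proof. by rewrite !dimvf. Qed.

Lemma zero_rep_iso N : is_zero_rep N -> rep_iso N (zero_rep k Q).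
Proof.
move=> N0; have eq0 v (x : N v) : x = 0.
  by apply/eqP; rewrite -memv0 (_ : 0%VS = fullv) ?memvf //;
    apply/eqP; rewrite eq_sym -dimv_eq0 N0.
apply: (@rep_iso_intro N (zero_rep k Q) (fun v x => 0)) => [v|v|a x].
- by move=> c x y; rewrite scaler0 addr0.
- by exists (fun=> 0) => x; rewrite ?[RHS]eq0 ?[RHS]zero_rep_eq0.
- by rewrite linear0.
Qed.

(** Without it, [multiplicity] could take its default value.  Induction on the
    total dimension, splitting a representation that is not indecomposable. *)
Lemma decomposition_exists N : exists s, is_decomposition N s.
Proof.
have [m] := ubnP (\sum_v \dim (fullv : {vspace N v})).
elim: m N => // m IHm N; rewrite ltnS => le_m.
have [N0|N0] := pselect (is_zero_rep N).
  by exists [::]; split=> //; apply: zero_rep_iso.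
have [iN|/not_andP[]//] := pselect (indecomposable N).
  exists [:: N]; split; last exact: dsum_zero_r.
  by rewrite /= andbT; apply/asboolP.
move=> /existsNP[A /existsNP[B /not_implyP[isoN /not_orP[A0 B0]]]].
have dimN : (\sum_v \dim (fullv : {vspace N v}) =
    \sum_v \dim (fullv : {vspace A v}) + \sum_v \dim (fullv : {vspace B v}))%N.
  rewrite -big_split; apply: eq_bigr => v _.
  by rewrite (rep_iso_dim v isoN) dsum_dim.
have pos L : ~ is_zero_rep L -> (0 < \sum_v \dim (fullv : {vspace L v}))%N.
  move=> L0; rewrite lt0n sum_nat_eq0; apply/negP => /forallP H; apply: L0 => v.
  exact/eqP/(implyP (H v)).
have [|sA [indA isoA]] := IHm A.
  by apply: leq_trans le_m; rewrite dimN -addn1 leq_add2l pos.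
have [|sB [indB isoB]] := IHm B.
  by apply: leq_trans le_m; rewrite dimN -add1n leq_add2r pos.
exists (sA ++ sB); split; first by rewrite all_cat indA.
apply: rep_iso_trans isoN _; apply: rep_iso_trans (dsum_cat sA sB).
exact: dsum_iso.
Qed.

End Decompositions.

(** * The pairing of an interval representation with a representation *)

Section Pairing.
Variables (k : fieldType) (Q : quiver) (I : {set Q}).
Implicit Types L M N : rep k Q.

(** A homomorphism V_I -> N is determined by the images y v in N v of the
    generators of V_I at v in I; sections encode homomorphisms in this way. *)
Definition is_section N (y : forall v, N v) : Prop :=
  (forall v, v \notin I -> y v = 0) /\
  (forall a : arrow Q, src a \in I -> rmap N a (y (src a)) = y (tgt a)).

(** Dually, a homomorphism N -> V_I is a family of linear forms. *)
Definition is_cosection N (p : forall v, 'Hom(N v, k^o)) : Prop :=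
  (forall v, v \notin I -> p v = 0) /\
  (forall a : arrow Q, tgt a \in I ->
     forall x, p (tgt a) (rmap N a x) = p (src a) x).

(** The pairing of sections with cosections has rank r iff it factors through a
    space with dual bases y and p of size r.  As a relation on witnesses, it is
    additive by concatenating them, with no need to assemble the sections into a
    vector space. *)
Definition has_pairing_rank N (v0 : Q) (r : nat) : Prop :=
  exists (T : finType) (y : T -> forall v, N v)
    (p : T -> forall v, 'Hom(N v, k^o)),
  [/\ #|T| = r, forall i, is_section (y i), forall i, is_cosection (p i),
      forall i j, p i v0 (y j v0) = (i == j)%:R &
      forall z q, is_section z -> is_cosection q ->
        q v0 (z v0) = \sum_i q v0 (y i v0) * p i v0 (z v0)].

(** An endomorphism of V_I is a scalar when I is connected, so the pairing may
    be evaluated at any vertex of I. *)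
Lemma pairing_constant N y p :
  @is_section N y -> is_cosection p -> connected_on I ->
  {in I &, forall u v, p u (y u) = p v (y v)}.
Proof.
move=> [_ yC] [_ pC] conI u v uI vI.
have cl : closed (adjacent_in I) [pred w | p w (y w) == p u (y u)].
  move=> w w' /and3P[wI w'I /existsP[a Ha]]; rewrite !inE.
  suff -> : p w (y w) = p w' (y w') by [].
  have E : src a \in I -> tgt a \in I ->
      p (tgt a) (y (tgt a)) = p (src a) (y (src a)).
    by move=> sI tI; rewrite -yC // pC.
  by case/orP: Ha => /andP[/eqP Es /eqP Et]; move: E;
     rewrite Es Et => ->.
have := closed_connect cl (conI u v uI vI).
by rewrite !inE eqxx => /esym/eqP.
Qed.

Lemma pairing_rank_iso M N v0 r : rep_iso M N ->
  has_pairing_rank N v0 r -> has_pairing_rank M v0 r.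
Proof.
case/rep_iso_elim => f [g [fK gK fC gC]] [T [y [p [cT sy sp yp full]]]].
exists T, (fun i v => g v (y i v)), (fun i v => (p i v \o f v)%VF); split=> //.
- move=> i; have [y0 yC] := sy i; split=> [v vI|a aI].
    by rewrite y0 // linear0.
  by rewrite -gC yC.
- move=> i; have [p0 pC] := sp i; split=> [v vI|a aI x].
    by rewrite p0 // comp_lfun0l.
  by rewrite !comp_lfunE fC pC.
- by move=> i j; rewrite comp_lfunE gK.
- move=> z q [z0 zC] [q0 qC].
  have sz : is_section (fun v => f v (z v)).
    split=> [v vI|a aI]; first by rewrite z0 // linear0.
    by rewrite -fC zC.
  have sq : is_cosection (fun v => (q v \o g v)%VF).
    split=> [v vI|a aI x]; first by rewrite q0 // comp_lfun0l.
    by rewrite !comp_lfunE gC qC.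
  have := full _ _ sz sq; rewrite comp_lfunE fK => ->.
  by apply: eq_bigr => i _; rewrite !comp_lfunE.
Qed.

Lemma pairing_rank_trivial N v0 :
  (forall y p, @is_section N y -> is_cosection p -> p v0 (y v0) = 0) ->
  has_pairing_rank N v0 0.
Proof.
move=> H; exists void, (@of_void _), (@of_void _).
split=> [|[]|[]|[]|z q sz sq]; first exact: card_void.
by rewrite H // big1 // => -[].
Qed.

Lemma pairing_rank_dsum M N v0 m r :
  has_pairing_rank M v0 m -> has_pairing_rank N v0 r ->
  has_pairing_rank (dsum_rep M N) v0 (m + r)%N.
Proof.
move=> [T [y [p [cT sy sp yp full]]]] [T' [y' [p' [cT' sy' sp' yp' full']]]].
have fstP v : exists h : 'Hom(dsum_rep M N v, M v), h =1 fst.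
  exact: hom_of.
have sndP v : exists h : 'Hom(dsum_rep M N v, N v), h =1 snd.
  exact: hom_of.
have inlP v : exists h : 'Hom(M v, dsum_rep M N v), h =1 (fun x => (x, 0)).
  by apply: hom_of => c u w; congr pair; rewrite /= scaler0 addr0.
have inrP v : exists h : 'Hom(N v, dsum_rep M N v), h =1 (fun x => (0, x)).
  by apply: hom_of => c u w; congr pair; rewrite /= scaler0 addr0.
pose pr1 v := projT1 (cid (fstP v)); pose pr2 v := projT1 (cid (sndP v)).
pose in1 v := projT1 (cid (inlP v)); pose in2 v := projT1 (cid (inrP v)).
have pr1E v x : pr1 v x = x.1 by rewrite /pr1; case: cid.
have pr2E v x : pr2 v x = x.2 by rewrite /pr2; case: cid.
have in1E v x : in1 v x = (x, 0) by rewrite /in1; case: cid.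
have in2E v x : in2 v x = (0, x) by rewrite /in2; case: cid.
pose Y (i : T + T') v : dsum_rep M N v :=
  match i with inl i => in1 v (y i v) | inr i => in2 v (y' i v) end.
pose P (i : T + T') v : 'Hom(dsum_rep M N v, k^o) :=
  match i with inl i => (p i v \o pr1 v)%VF | inr i => (p' i v \o pr2 v)%VF end.
exists (T + T')%type, Y, P; split.
- by rewrite card_sum cT cT'.
- case=> i; [have [y0 yC] := sy i | have [y0 yC] := sy' i];
    split=> [v vI|a aI]; rewrite /Y ?in1E ?in2E ?dsum_rmapE /= ?linear0;
    by rewrite (y0, yC).
- case=> i; [have [p0 pC] := sp i | have [p0 pC] := sp' i].
    split=> [v vI|a aI x]; rewrite /P; first by rewrite p0 // comp_lfun0l.
    by rewrite !comp_lfunE ?pr1E ?pr2E dsum_rmapE /= pC.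
  split=> [v vI|a aI x]; rewrite /P; first by rewrite p0 // comp_lfun0l.
  by rewrite !comp_lfunE ?pr1E ?pr2E dsum_rmapE /= pC.
- case=> i [] j; rewrite /P /Y comp_lfunE;
    rewrite ?pr1E ?pr2E ?in1E ?in2E /= ?linear0 //.
- move=> z q [z0 zC] [q0 qC].
  have sz1 : @is_section M (fun v => (z v).1).
    split=> [v vI|a aI]; first by rewrite z0.
    by have := zC a aI; rewrite dsum_rmapE => <-.
  have sz2 : @is_section N (fun v => (z v).2).
    split=> [v vI|a aI]; first by rewrite z0.
    by have := zC a aI; rewrite dsum_rmapE => <-.
  have sq1 : is_cosection (fun v => (q v \o in1 v)%VF).
    split=> [v vI|a aI x]; first by rewrite q0 // comp_lfun0l.
    by rewrite !comp_lfunE !in1E -qC // dsum_rmapE /= linear0.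
  have sq2 : is_cosection (fun v => (q v \o in2 v)%VF).
    split=> [v vI|a aI x]; first by rewrite q0 // comp_lfun0l.
    by rewrite !comp_lfunE !in2E -qC // dsum_rmapE /= linear0.
  rewrite big_sumType /=.
  have -> : q v0 (z v0) = q v0 (in1 v0 (z v0).1) + q v0 (in2 v0 (z v0).2).
    rewrite -linearD in1E in2E; congr (q v0 _).
    by case: (z v0) => s t; congr pair; rewrite /= ?addr0 ?add0r.
  have E1 := full _ _ sz1 sq1; have E2 := full' _ _ sz2 sq2.
  rewrite !comp_lfunE in E1 E2; rewrite E1 E2.
  by congr (_ + _); apply: eq_bigr => i _; rewrite !comp_lfunE ?pr1E ?pr2E.
Qed.

Lemma interval_rmapE (a : arrow Q) (x : interval_rep k I (src a)) :
  rmap (interval_rep k I) a x =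
  x *m (const_mx 1 : 'M[k]_(src a \in I, tgt a \in I)).
Proof. by rewrite [LHS](lfunE (mulmxr _)). Qed.

Lemma const_mulmx (a b c : bool) : b ->
  (const_mx 1 : 'M[k]_(a, b)) *m (const_mx 1 : 'M[k]_(b, c)) = const_mx 1.
Proof.
by case: b => // _; apply/matrixP => i j; rewrite !mxE big_ord1 !mxE mulr1.
Qed.

Lemma const_mx_bool (a : bool) : (const_mx 1 : 'M[k]_a) = 1%:M.
Proof.
by case: a; apply/matrixP => i j; [rewrite !ord1 !mxE | case: i].
Qed.

Lemma row_bool0 (a : bool) (x : 'rV[k]_a) : ~~ a -> x = 0.
Proof. by case: a x => // x _; exact: thinmx0. Qed.

(** The generators of V_I and the coordinate forms dual to them; both the rank
    of V_I and the splitting off of V_I are computed with this basis. *)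
Lemma interval_generator :
  exists (e : forall v, interval_rep k I v)
    (p : forall v, 'Hom(interval_rep k I v, k^o)),
  [/\ is_section e, is_cosection p, {in I, forall v, p v (e v) = 1} &
      forall v x, x = p v x *: e v].
Proof.
have pP v : exists h : 'Hom(interval_rep k I v, k^o),
    forall x : 'rV[k]_(v \in I),
      h x = (x *m (const_mx 1 : 'M[k]_(v \in I, true))) 0 0.
  apply: (@hom_of k (interval_rep k I v) k^o
    (fun x : 'rV[k]_(v \in I) =>
       (x *m (const_mx 1 : 'M[k]_(v \in I, true))) 0 0)).
  by move=> c u w; rewrite mulmxDl -scalemxAl !mxE.
pose p v := projT1 (cid (pP v)).
have pE v (x : 'rV[k]_(v \in I)) :
    p v x = (x *m (const_mx 1 : 'M[k]_(v \in I, true))) 0 0.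
  by rewrite /p; case: cid.
pose e v : interval_rep k I v := (const_mx 1 : 'M[k]_(true, v \in I)).
exists e, p; split=> [||v vI|v x].
- split=> [v vI|a aI]; first exact: row_bool0.
  by rewrite interval_rmapE /e (@const_mulmx true (src a \in I)).
- split=> [v vI|a aI x].
    by apply/lfunP => x; rewrite (@row_bool0 (v \in I) x) // !linear0.
  by rewrite interval_rmapE !pE -mulmxA const_mulmx.
- by rewrite pE /e (@const_mulmx true (v \in I)) // mxE.
- rewrite pE /e; move: x => /=; case: (v \in I) => x;
    last by rewrite [LHS]thinmx0 [RHS]thinmx0.
  apply/rowP => j; rewrite !mxE big_ord1 !mxE !mulr1.
  by congr (x _ _); rewrite ord1.
Qed.

Lemma pairing_rank_interval v0 : v0 \in I ->
  has_pairing_rank (interval_rep k I) v0 1.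
Proof.
move=> v0I; have [e [p [se sp pe genE]]] := interval_generator.
exists unit, (fun=> e), (fun=> p); split=> // [|[] []|z q sz sq].
- by rewrite card_unit.
- by rewrite pe.
- rewrite (big_pred1 tt) => [|[]]; last by rewrite /= eqxx.
  by rewrite {1}[z v0]genE linearZ /= mulrC.
Qed.
End Pairing.

(** * Multiplicity of an interval representation *)

Section Multiplicity.
Variables (k : fieldType) (Q : quiver) (I : {set Q}).
Implicit Types L M N : rep k Q.

(** The cosection p is a retraction of the homomorphism given by y, so its
    kernel K is a complement of V_I in L. *)
Lemma interval_summand L (y : forall v, L v) (p : forall v, 'Hom(L v, k^o)) :
  is_section I y -> is_cosection I p -> {in I, forall v, p v (y v) = 1} ->
  exists K : rep k Q, rep_iso L (dsum_rep (interval_rep k I) K).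
Proof.
move=> [y0 yC] [p0 pC] py.
pose K := @Rep k Q (fun v => subvs_of (lker (p v)) : vectType k)
  (fun a => linfun (fun x : subvs_of (lker (p (src a))) =>
     vsproj (lker (p (tgt a))) (rmap L a (vsval x)))).
have KE a (x : subvs_of (lker (p (src a)))) :
    vsval (rmap K a x : subvs_of _) = rmap L a (vsval x).
  rewrite [rmap K a x]linfun_linear; last by move=> c u w; rewrite !linearP.
  rewrite vsprojK // memv_ker; have [tI|/negP tI] := pselect (tgt a \in I).
    by rewrite pC // -memv_ker subvsP.
  by rewrite p0 // zero_lfunE.
exists K.
have [e [ev [[e0 eC] [ev0 evC] eve genE]]] := interval_generator k I.
have inK v x : x - p v x *: y v \in lker (p v).
  rewrite memv_ker linearB linearZ /= subr_eq0.
  have [vI|/negP vI] := pselect (v \in I).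
    by rewrite py // /GRing.scale /= mulr1.
  by rewrite p0 // zero_lfunE scale0r.
(* The decomposition of x along the image of the section and its complement. *)
pose f v (x : L v) : dsum_rep (interval_rep k I) K v :=
  (p v x *: e v, vsproj (lker (p v)) (x - p v x *: y v)).
apply: (@rep_iso_intro _ _ _ _ f) => [v c u w|v|a x].
- congr pair; first by rewrite linearP /= scalerDl scalerA.
  rewrite /f /= -[RHS]linearP /=; congr (vsproj _ _).
  by rewrite linearP /= scalerDl scalerBr opprD addrACA scalerA.
- pose g (z : dsum_rep (interval_rep k I) K v) : L v :=
    ev v z.1 *: y v + vsval (z.2 : subvs_of (lker (p v))).
  exists g => [x|[x z]]; rewrite /g /f /=.
    rewrite (vsprojK (inK _ _)); have [vI|/negP vI] := pselect (v \in I).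
      by rewrite linearZ /= eve // /GRing.scale /= mulr1 addrC subrK.
    by rewrite y0 // !scaler0 add0r subr0.
  have /eqP pz : p v (vsval z) == 0 by rewrite -memv_ker subvsP.
  have pa : p v (ev v x *: y v + vsval z) = ev v x.
    rewrite linearD linearZ /= pz addr0.
    have [vI|/negP vI] := pselect (v \in I).
      by rewrite py // /GRing.scale /= mulr1.
    by rewrite ev0 // zero_lfunE scale0r.
  by congr pair; rewrite pa; [rewrite -genE | rewrite addrC addKr vsvalK].
- rewrite dsum_rmapE; congr pair; rewrite /f /=.
    rewrite linearZ /=; have [sI|/negP sI] := pselect (src a \in I).
      rewrite eC //; have [tI|/negP tI] := pselect (tgt a \in I).
        by rewrite pC.
      by rewrite e0 // !scaler0.
    rewrite (e0 _ sI) linear0 scaler0.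
    have [tI|/negP tI] := pselect (tgt a \in I).
      by rewrite pC // p0 // zero_lfunE scale0r.
    by rewrite e0 // scaler0.
  apply: val_inj; rewrite [RHS]KE /= !(vsprojK (inK _ _)).
  rewrite linearB [X in _ = _ - X]linearZ /=.
  congr (_ - _); have [tI|/negP tI] := pselect (tgt a \in I).
    rewrite pC //; have [sI|/negP sI] := pselect (src a \in I).
      by rewrite yC.
    by rewrite p0 // zero_lfunE !scale0r.
  rewrite y0 // scaler0; have [sI|/negP sI] := pselect (src a \in I).
    by rewrite yC // y0 // scaler0.
  by rewrite y0 // linear0 scaler0.
Qed.

(** V_I splits off as a summand once y is rescaled, and the complement in an
    indecomposable vanishes. *)
Lemma indecomposable_interval L v0 (y : forall v, L v)
    (p : forall v, 'Hom(L v, k^o)) :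
  connected_on I -> v0 \in I -> indecomposable L ->
  is_section I y -> is_cosection I p -> p v0 (y v0) != 0 ->
  rep_iso L (interval_rep k I).
Proof.
move=> conI v0I [_ indL] sy sp nz.
have [|||K isoK] := @interval_summand L (fun v => (p v0 (y v0))^-1 *: y v) p.
- case: sy => [y0 yC]; split=> [v vI|a aI]; first by rewrite (y0 v) // scaler0.
  by rewrite linearZ /= yC.
- exact: sp.
- move=> v vI; rewrite linearZ /= (pairing_constant sy sp conI vI v0I).
  exact: mulVf.
case: (indL _ _ isoK) => [V0|K0].
  by have := V0 v0; rewrite dimvf /dim /= v0I.
apply: rep_iso_trans isoK _; apply: rep_iso_trans (rep_iso_sym (dsum_zero_r _)).
exact: dsum_iso (rep_iso_refl _) (zero_rep_iso K0).
Qed.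

(** Every decomposition of N yields dual bases indexed by its summands
    isomorphic to V_I, because the pairing vanishes on all the others. *)
Lemma multiplicity_pairing_rank N L v0 : connected_on I -> v0 \in I ->
  rep_iso L (interval_rep k I) ->
  has_pairing_rank I N v0 (multiplicity N L).
Proof.
move=> conI v0I isoL; rewrite /multiplicity.
case: pselect => [ex|[]]; last first.
  have [s decs] := decomposition_exists N.
  by exists (count (fun L' => `[< rep_iso L' L >]) s), s.
case: cid => m /= [s [inds isoN] ->].
apply: pairing_rank_iso isoN _.
elim: s inds => /= [_|A s IHs /andP[/asboolP iA /IHs]].
  apply: pairing_rank_trivial => y p sy _.
  by rewrite [y v0]zero_rep_eq0 linear0.
apply: pairing_rank_dsum; case: asboolP => [isoA|nisoA].
  apply: pairing_rank_iso (rep_iso_trans isoA isoL) _.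
  exact: pairing_rank_interval.
apply: pairing_rank_trivial => y p sy sp; apply/eqP.
apply: contra_notT nisoA => nz.
apply: rep_iso_trans (indecomposable_interval conI v0I iA sy sp nz) _.
exact: (rep_iso_sym isoL).
Qed.
End Multiplicity.

(** * Representations pulled back from a commutative one *)

Lemma composite_cat (k : fieldType) (Q : quiver) (M : rep k Q) (u v w : Q)
    (p : qpath u v) (q : qpath v w) :
  exists r : qpath u w, forall x,
    composite M r x = composite M q (composite M p x).
Proof.
elim: p q => [z|a z p IHp] q /=; first by exists q => x; rewrite id_lfunE.
have [r Hr] := IHp q; exists (qcons r) => x /=.
by rewrite !comp_lfunE Hr.
Qed.

(** A representation of C with space M (F c) at c and acting through paths of Q.
    This covers at once the tours of M and its two rows. *)
Section Pullback.
Variables (k : fieldType) (Q : quiver) (M : rep k Q).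
Hypothesis commM : commutative_rep M.
Variables (C : quiver) (F : C -> Q).
Variable nu : forall a : arrow C, 'Hom(M (F (src a)), M (F (tgt a))).
Hypothesis nu_path : forall a : arrow C,
  exists p : qpath (F (src a)) (F (tgt a)), nu a = composite M p.
Variables (I : {set C}) (c0 c1 : C).
Hypotheses (conI : connected_on I) (c0I : c0 \in I) (c1I : c1 \in I).
Hypothesis path_from : {in I, forall c, inhabited (qpath (F c0) (F c))}.
Hypothesis path_to : {in I, forall c, inhabited (qpath (F c) (F c1))}.

Let N : rep k C := @Rep k C (fun c => M (F c)) nu.

Lemma nu_after (a : arrow C) (u : Q) (p : qpath u (F (src a)))
    (q : qpath u (F (tgt a))) x :
  nu a (composite M p x) = composite M q x.
Proof.
have [r ->] := nu_path a; have [s <-] := composite_cat M p r.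
by rewrite (commM s q).
Qed.

Lemma nu_before (a : arrow C) (u : Q) (p : qpath (F (tgt a)) u)
    (q : qpath (F (src a)) u) x :
  composite M p (nu a x) = composite M q x.
Proof.
have [r ->] := nu_path a; have [s <-] := composite_cat M r p.
by rewrite (commM s q).
Qed.

Lemma composite_loop u (p : qpath u u) x : composite M p x = x.
Proof. by rewrite (commM p (qnil u)) /= id_lfunE. Qed.

(** M (F c -> F c1) (y c) does not change along arrows of C inside I, and I is
    connected; compare the values at c0 and c1.  The vector y c itself need not
    be the image of y c0, since C may zigzag. *)
Lemma section_transport y (p : qpath (F c0) (F c1)) :
  @is_section k C I N y -> y c1 = composite M p (y c0).
Proof.
move=> [y0 yC].
pose out c : 'Hom(M (F c), M (F c1)) :=
  if pselect (inhabited (qpath (F c) (F c1))) is left q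
  then transition M q else 0.
have outE c (q : qpath (F c) (F c1)) x : out c x = composite M q x.
  rewrite /out; case: pselect => [q'|[]]; last by constructor.
  by rewrite /transition (commM _ q).
have cl : closed (adjacent_in I) [pred c | out c (y c) == y c1].
  move=> c c' /and3P[cI c'I /existsP[a Ha]]; rewrite !inE.
  suff -> : out c (y c) = out c' (y c') by [].
  have E : src a \in I -> tgt a \in I ->
      out (tgt a) (y (tgt a)) = out (src a) (y (src a)).
    move=> sI tI; have [q] := path_to sI; have [q'] := path_to tI.
    by rewrite (outE _ q) (outE _ q') -yC // (nu_before q' q).
  by case/orP: Ha => /andP[/eqP Es /eqP Et]; move: E; rewrite Es Et => ->.
have := closed_connect cl (conI c1I c0I); rewrite !inE.
by rewrite (outE c1 (qnil _)) /= id_lfunE eqxx (outE c0 p) => /esym/eqP.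
Qed.

(** Dual to the transport of sections: q c (M (F c0 -> F c) x) does not depend
    on c in I. *)
Lemma cosection_transport (q : forall c, 'Hom(N c, k^o))
    (p : qpath (F c0) (F c1)) x :
  is_cosection I q -> q c0 x = q c1 (composite M p x).
Proof.
move=> [q0 qC].
pose inn c : 'Hom(M (F c0), M (F c)) :=
  if pselect (inhabited (qpath (F c0) (F c))) is left q
  then transition M q else 0.
have innE c (r : qpath (F c0) (F c)) : inn c x = composite M r x.
  rewrite /inn; case: pselect => [q'|[]]; last by constructor.
  by rewrite /transition (commM _ r).
have cl : closed (adjacent_in I) [pred c | q c (inn c x) == q c0 x].
  move=> c c' /and3P[cI c'I /existsP[a Ha]]; rewrite !inE.
  suff -> : q c (inn c x) = q c' (inn c' x) by [].
  have E : src a \in I -> tgt a \in I ->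
      q (tgt a) (inn (tgt a) x) = q (src a) (inn (src a) x).
    move=> sI tI; have [r] := path_from sI; have [r'] := path_from tI.
    by rewrite (innE _ r) (innE _ r') -qC // [rmap N a _](nu_after r r').
  by case/orP: Ha => /andP[/eqP Es /eqP Et]; move: E; rewrite Es Et => ->.
have := closed_connect cl (conI c0I c1I); rewrite !inE.
by rewrite (innE c0 (qnil _)) /= id_lfunE eqxx (innE c1 p) => /esym/eqP.
Qed.

(** Sections and cosections are transported to c0 and c1, where their pairing is
    given by f.  The maps h and g record the constraints from the arrows leaving
    and entering I: the first two hypotheses say that these constraints are
    necessary, the next two that they suffice to extend an element of M (F c0)
    to a section and a form on M (F c1) to a cosection. *)
Lemma pullback_rank_formula (p01 : qpath (F c0) (F c1)) (X Y : vectType k)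
    (g : 'Hom(X, M (F c0))) (h : 'Hom(M (F c1), Y)) (r : nat) :
  let f := composite M p01 in
  (forall y, @is_section k C I N y -> h (y c1) = 0) ->
  (forall q : forall c, 'Hom(N c, k^o), is_cosection I q ->
     forall z, q c0 (g z) = 0) ->
  (forall a, src a \in I -> tgt a \notin I ->
     forall (p : qpath (F c0) (F (src a))) x,
       h (f x) = 0 -> nu a (composite M p x) = 0) ->
  (forall a, src a \notin I -> tgt a \in I ->
     forall (p : qpath (F (tgt a)) (F c1)) (psi : 'Hom(M (F c1), k^o)),
       (forall z, psi (f (g z)) = 0) ->
       forall x, psi (composite M p (nu a x)) = 0) ->
  has_pairing_rank I N c1 r ->
  (r + \dim (limg (h \o f)) + \dim (limg (f \o g)) =
   \dim (limg f) + \dim (limg (h \o f \o g)))%N.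
Proof.
move=> f exit entry exit' entry' [T [y [q [<- sy sq qy full]]]].
have fE x : f x = composite M p01 x by [].
apply: (@induced_pairing_rank k X (M (F c0)) (M (F c1)) Y g f h T
  (fun i => y i c0) (fun i => q i c1)).
- by move=> i; rewrite fE -(section_transport p01 (sy i)) exit.
- by move=> i z; rewrite fE -(cosection_transport p01 _ (sq i)) entry.
- by move=> i j; rewrite fE -(section_transport p01 (sy j)) qy.
move=> x psi hx psig.
have innP c : exists t : 'Hom(M (F c0), M (F c)),
    (c \in I -> exists p, t = composite M p) /\ (c \notin I -> t = 0).
  have [cI|cI] := boolP (c \in I); last by exists 0.
  by have [p] := path_from cI; exists (composite M p); split=> // _; exists p.
have outP c : exists t : 'Hom(M (F c), M (F c1)),
    (c \in I -> exists p, t = composite M p) /\ (c \notin I -> t = 0).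
  have [cI|cI] := boolP (c \in I); last by exists 0.
  by have [p] := path_to cI; exists (composite M p); split=> // _; exists p.
pose inn c := projT1 (cid (innP c)); pose out c := projT1 (cid (outP c)).
have inn1 c : c \in I -> exists p, inn c = composite M p.
  by rewrite /inn; case: cid => t [].
have inn0 c : c \notin I -> inn c = 0 by rewrite /inn; case: cid => t [].
have out1 c : c \in I -> exists p, out c = composite M p.
  by rewrite /out; case: cid => t [].
have out0 c : c \notin I -> out c = 0 by rewrite /out; case: cid => t [].
have sz : @is_section k C I N (fun c => inn c x).
  split=> [c cI|a sI]; first by rewrite inn0 // zero_lfunE.
  have [p ->] := inn1 _ sI; have [tI|tI] := boolP (tgt a \in I).
    by have [p' ->] := inn1 _ tI; apply: nu_after.
  by rewrite inn0 // zero_lfunE; apply: exit'.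
have st : @is_cosection k C I N (fun c => (psi \o out c)%VF).
  split=> [c cI|a tI z]; first by rewrite out0 // comp_lfun0r.
  rewrite !comp_lfunE; have [p ->] := out1 _ tI.
  have [sI|sI] := boolP (src a \in I).
    by have [p' ->] := out1 _ sI; congr (psi _); apply: nu_before.
  by rewrite (out0 _ sI) zero_lfunE linear0; apply: entry'.
have := full _ _ sz st; rewrite comp_lfunE.
have [p ->] := out1 _ c1I; have [p' ->] := inn1 _ c1I.
rewrite composite_loop (commM p' p01) -fE => ->.
apply: eq_bigr => i _.
by rewrite comp_lfunE composite_loop fE -(section_transport p01 (sy i)).
Qed.
End Pullback.

(** * Compressed multiplicities as ranks *)

Section RankBetween.
Variables (k : fieldType) (Q : quiver) (M : rep k Q).
Hypothesis commM : commutative_rep M.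

Definition rank_between (u v : Q) : nat :=
  if pselect (inhabited (qpath u v)) is left uv
  then \dim (limg (transition M uv)) else 0%N.

Lemma rank_betweenE u v (p : qpath u v) :
  rank_between u v = \dim (limg (composite M p)).
Proof.
rewrite /rank_between; case: pselect => [uv|[]]; last by constructor.
by rewrite /transition (commM _ p).
Qed.
End RankBetween.

Section Tour.
Variables (k : fieldType) (Q : quiver) (M : rep k Q).
Hypothesis commM : commutative_rep M.

Lemma composite_interval (I : {set Q}) (u v : Q) (p : qpath u v) :
  {subset qvertices p <= I} -> forall x : 'rV[k]_(u \in I),
  composite (interval_rep k I) p x =
  x *m (const_mx 1 : 'M[k]_(u \in I, v \in I)).
Proof.
elim: p => [w|a w p IHp] /= sI x.
  by rewrite id_lfunE const_mx_bool mulmx1.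
rewrite comp_lfunE interval_rmapE IHp => [|z zp]; last first.
  by apply: sI; rewrite inE zp orbT.
rewrite -mulmxA const_mulmx //; apply: sI; rewrite inE; apply/orP; right.
by case: p {IHp} => *; rewrite inE eqxx.
Qed.

Lemma tour_interval (I : {set Q}) (C : course Q) :
  qconvex I -> [set cmap c | c : cquiver C] \subset I ->
  rep_iso (tour C (interval_rep k I)) (interval_rep k [set: cquiver C]).
Proof.
move=> cvxI /subsetP sub.
have FI (c : cquiver C) : cmap c \in I by apply/sub/imsetP; exists c.
have TI (c : cquiver C) : c \in [set: cquiver C] by rewrite inE.
have fP c : exists h : 'Hom(tour C (interval_rep k I) c,
    interval_rep k [set: cquiver C] c),
    forall x : 'rV[k]_(cmap c \in I),
      h x = x *m (const_mx 1 : 'M[k]_(cmap c \in I, c \in [set: cquiver C])).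
  apply: (@hom_of k (interval_rep k I (cmap c))
    (interval_rep k [set: cquiver C] c)
    (fun x : 'rV[k]_(cmap c \in I) =>
       x *m (const_mx 1 : 'M[k]_(cmap c \in I, c \in [set: cquiver C])))).
  by move=> a u w; rewrite mulmxDl -scalemxAl.
pose f c := projT1 (cid (fP c)).
have fE c (x : 'rV[k]_(cmap c \in I)) :
    f c x = x *m (const_mx 1 : 'M[k]_(cmap c \in I, c \in [set: cquiver C])).
  by rewrite /f; case: cid.
apply: (@rep_iso_intro k (cquiver C) (tour C (interval_rep k I))
  (interval_rep k [set: cquiver C]) (fun c => f c)).
- by move=> c a u w; rewrite linearP.
- move=> c; exists (fun x : 'rV[k]_(c \in [set: cquiver C]) =>
    x *m (const_mx 1 : 'M[k]_(c \in [set: cquiver C], cmap c \in I))) => x.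
    rewrite fE -mulmxA const_mulmx // const_mx_bool mulmx1 //.
  by rewrite fE -mulmxA const_mulmx // const_mx_bool mulmx1.
- move=> a x; rewrite interval_rmapE !fE /= /transition.
  rewrite composite_interval; last exact: cvxI.
  by rewrite -!mulmxA !const_mulmx.
Qed.

(** All vertices of the course are mapped into I, so no arrow enters or leaves
    the support of the constant representation, and the rank formula is applied
    with g = h = 0. *)
Lemma tour_multiplicity (I : {set Q}) (C : course Q) (c0 c1 : cquiver C) :
  qconvex I -> [set cmap c | c : cquiver C] \subset I ->
  (forall c : cquiver C, inhabited (qpath (cmap c0) (cmap c))) ->
  (forall c : cquiver C, inhabited (qpath (cmap c) (cmap c1))) ->
  multiplicity (tour C M) (tour C (interval_rep k I)) =
  rank_between M (cmap c0) (cmap c1).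
Proof.
move=> cvxI sub from to; have [p] := from c1; rewrite (rank_betweenE commM p).
have [_ conC] := course_connected C.
have TI (c : cquiver C) : c \in [set: cquiver C] by rewrite inE.
have := multiplicity_pairing_rank (tour C M) conC (TI c1)
  (tour_interval cvxI sub).
have nuP (a : arrow (cquiver C)) :
    exists p, transition M (course_path a) = composite M p.
  by exists (inhabited_witness (course_path a)).
move=> /(@pullback_rank_formula k Q M commM _ (@cmap Q C) _ nuP _
  c0 c1 conC (TI _) (TI _)
  (fun c _ => from c) (fun c _ => to c) p (M (cmap c0)) (M (cmap c1)) 0 0 _).
rewrite !comp_lfun0l !comp_lfun0r lim0g dimv0 !addn0; apply.
- by move=> y _; rewrite zero_lfunE.
- by move=> q _ z; rewrite zero_lfunE linear0.
- by move=> a _; rewrite TI.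
- by move=> a; rewrite TI.
Qed.
End Tour.

Local Close Scope ring_scope.

(** * Multiplicities in a row of the ladder *)

Definition next_col (n : nat) (d : 'I_n) : option 'I_n := insub d.+1.

Definition prev_col (n : nat) (b : 'I_n) : option 'I_n :=
  if b : nat is m.+1 then insub m else None.

Lemma next_colP n (d : 'I_n) (i : 'I_n) :
  (next_col d == Some i) = (i == d.+1 :> nat).
Proof.
rewrite /next_col; case: insubP => [j _ E|nd].
  by rewrite -E; apply/eqP/eqP => [[->]|/val_inj ->].
by apply/esym; apply/eqP => E; rewrite -E ltn_ord in nd.
Qed.

Lemma prev_colP n (b : 'I_n) (i : 'I_n) :
  (prev_col b == Some i) = (i.+1 == b :> nat).
Proof.
rewrite /prev_col; case E: (b : nat) => [|m] //.
have lm : m < n by apply: ltn_trans (ltn_ord b); rewrite E.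
rewrite insubT /= eqSS; apply/eqP/eqP => [[<-] //|Em].
by congr Some; apply: val_inj.
Qed.

Lemma A_segment_connected n (b d : 'I_n) : connected_on (A_segment b d).
Proof.
have H (i : 'I_n) : i \in A_segment b d ->
    connect (adjacent_in (A_segment b d)) b i.
  have [m] := ubnP i; elim: m i => // m IHm i lt_m.
  rewrite inE => /andP[]; rewrite leq_eqVlt.
  case/orP=> [/eqP/val_inj-> //|lt_bi le_id].
  have lt_i : i.-1 < n by apply: leq_ltn_trans (leq_pred _) (ltn_ord i).
  have Ei : i.-1.+1 = i by rewrite prednK // (leq_ltn_trans _ lt_bi).
  have Hi : Ordinal lt_i \in A_segment b d.
    by rewrite inE /= -ltnS Ei lt_bi (leq_trans (leq_pred _)).
  apply: connect_trans (IHm (Ordinal lt_i) _ Hi) _; first by rewrite /= Ei.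
  have arr : A_rel (Ordinal lt_i, i).1 (Ordinal lt_i, i).2.
    by rewrite /A_rel /= Ei.
  apply: connect1; apply/and3P; split=> //; first by rewrite inE (ltnW lt_bi).
  by apply/existsP; exists (exist _ (Ordinal lt_i, i) arr); rewrite /= !eqxx.
move=> u v /H Hu /H Hv; apply: connect_trans Hv.
by rewrite adjacent_in_sym.
Qed.

Section Rows.
Variables (k : fieldType) (n : nat) (M : rep k (CL n)).
Hypothesis commM : commutative_rep M.
Variable j : bool.

(** A column outside the ladder is None and contributes rank 0, as if the row
    were extended by zero on both sides. *)
Definition row_rank (o1 o2 : option 'I_n) : nat :=
  if (o1, o2) is (Some b, Some d) then rank_between M (b, j) (d, j) else 0.

Lemma row_arrow_path (a : arrow (A_quiver n)) :
  exists p : @qpath (CL n) (src a, j) (tgt a, j),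
    rmap M (row_arrow j a) = composite M p.
Proof.
exists (qcons (qnil (tgt (row_arrow j a)))) => /=.
by rewrite comp_lfun1l.
Qed.

(** The only arrow that can leave the segment starts at d; h is the map of M on
    it, or 0 when d is the last column. *)
Lemma exit_map (b d : 'I_n) :
  exists (Y : vectType k) (h : 'Hom(M (d, j), Y)),
  [/\ forall y, @is_section k _ (A_segment b d) (row_rep M j) y ->
        h (y d) = 0%R,
      forall a : arrow (A_quiver n), src a \in A_segment b d ->
        tgt a \notin A_segment b d ->
        forall u (p : @qpath (CL n) u (d, j)) (p' : @qpath (CL n) u (src a, j))
          x,
          h (composite M p x) = 0%R ->
          rmap M (row_arrow j a) (composite M p' x) = 0%R &
      if next_col d is Some d' then
        forall u (p : @qpath (CL n) u (d, j)),
          \dim (limg (h \o composite M p)) = rank_between M u (d', j)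
      else h = 0%R ].
Proof.
have last_arrow (a : arrow (A_quiver n)) : src a \in A_segment b d ->
    tgt a \notin A_segment b d -> src a = d /\ next_col d = Some (tgt a).
  case: a => -[s t] /= st; rewrite !inE /= => /andP[bs sd].
  have Est : s.+1 = t by apply/eqP.
  rewrite -Est (leq_trans bs (leqnSn _)) /= -leqNgt => ds.
  have E : s = d by apply/val_inj/anti_leq; rewrite sd.
  by split=> //; apply/eqP; rewrite next_colP -Est E.
case E: (next_col d) => [d'|]; last first.
  exists (M (d, j)), 0%R; split=> // [y _|a sI tI]; first by rewrite zero_lfunE.
  by have [_] := last_arrow a sI tI; rewrite E.
have dd' : d' = d.+1 :> nat by apply/eqP; rewrite -next_colP E.
have arr : A_rel (d, d').1 (d, d').2 by rewrite /A_rel /= dd'.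
pose a0 : arrow (A_quiver n) := exist _ (d, d') arr.
have a0E (a : arrow (A_quiver n)) : src a = d -> tgt a = d' -> a = a0.
  by case: a => -[s t] st /= Es Et; apply: val_inj; rewrite /= Es Et.
exists (M (d', j)), (rmap M (row_arrow j a0)); split.
- move=> y [y0 yC].
  have [dI|dI] := boolP (d \in A_segment b d); last by rewrite y0 // linear0.
  have := yC a0 dI; rewrite /= => ->; apply: y0.
  by rewrite inE /= dd' ltnn andbF.
- move=> a sI tI u p p' x; have [Es] := last_arrow a sI tI.
  rewrite E => -[/esym Et]; have Ea := a0E a Es Et; subst a => /=.
  by rewrite (commM p' p).
- move=> u p; have [q Eq] := row_arrow_path a0.
  have [r Er] := composite_cat M p q.
  rewrite (rank_betweenE commM r); congr (\dim (limg _)).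
  by apply/lfunP => x; rewrite Er comp_lfunE Eq.
Qed.

(** Dually, g is the map of M on the arrow that ends at b, or 0 when b is the
    first column.  The ranks are taken after an arbitrary map t so that they can
    be combined with those of the exit map. *)
Lemma entry_map (b d : 'I_n) :
  exists (X : vectType k) (g : 'Hom(X, M (b, j))),
  [/\ forall q, @is_cosection k _ (A_segment b d) (row_rep M j) q ->
        forall z, q b (g z) = 0%R,
      forall a : arrow (A_quiver n), src a \notin A_segment b d ->
        tgt a \in A_segment b d ->
        forall u (p : @qpath (CL n) (b, j) u) (p' : @qpath (CL n) (tgt a, j) u)
          (psi : 'Hom(M u, k^o)),
          (forall z, psi (composite M p (g z)) = 0%R) ->
          forall x, psi (composite M p' (rmap M (row_arrow j a) x)) = 0%R &
      if prev_col b is Some b' then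
        forall u (p : @qpath (CL n) (b, j) u),
          exists r : @qpath (CL n) (b', j) u,
          forall (Y : vectType k) (t : 'Hom(M u, Y)),
          \dim (limg (t \o composite M p \o g)) =
          \dim (limg (t \o composite M r))
      else g = 0%R ].
Proof.
have first_arrow (a : arrow (A_quiver n)) : src a \notin A_segment b d ->
    tgt a \in A_segment b d -> tgt a = b /\ prev_col b = Some (src a).
  case: a => -[s t] /= st; rewrite !inE /= => sI /andP[bt td].
  have Est : s.+1 = t by apply/eqP.
  have sb : s < b.
    rewrite ltnNge; apply: contra sI => bs; rewrite bs /=.
    by apply: leq_trans td; rewrite -Est.
  have E : t = b by apply/val_inj/anti_leq; rewrite /= bt -Est sb.
  by split=> //; apply/eqP; rewrite prev_colP Est E.
case E: (prev_col b) => [b'|]; last first.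
  exists (M (b, j)), 0%R; split=> // [q _ z|a sI tI].
    by rewrite zero_lfunE linear0.
  by have [_] := first_arrow a sI tI; rewrite E.
have bb' : b'.+1 = b :> nat by apply/eqP; rewrite -prev_colP E.
have arr : A_rel (b', b).1 (b', b).2 by rewrite /A_rel /= bb'.
pose a0 : arrow (A_quiver n) := exist _ (b', b) arr.
have a0E (a : arrow (A_quiver n)) : src a = b' -> tgt a = b -> a = a0.
  by case: a => -[s t] st /= Es Et; apply: val_inj; rewrite /= Es Et.
exists (M (b', j)), (rmap M (row_arrow j a0)); split.
- move=> q [q0 qC] z.
  have [bI|bI] := boolP (b \in A_segment b d); last by rewrite q0 // zero_lfunE.
  have := qC a0 bI z; rewrite /= => ->; rewrite q0 ?zero_lfunE //.
  by rewrite inE /= -bb' ltnn.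
- move=> a sI tI u p p' psi; have [Et] := first_arrow a sI tI.
  rewrite E => -[/esym Es]; have Ea := a0E a Es Et; subst a => Hz x /=.
  by rewrite (commM p' p).
- move=> u p; have [q Eq] := row_arrow_path a0.
  have [r Er] := composite_cat M q p; exists r => Y t; congr (\dim (limg _)).
  by apply/lfunP => x; rewrite !comp_lfunE Er Eq.
Qed.

Lemma row_multiplicity (b d : 'I_n) : b <= d ->
  (multiplicity (row_rep M j) (interval_rep k (A_segment b d)) +
   row_rank (Some b) (next_col d) + row_rank (prev_col b) (Some d) =
   row_rank (Some b) (Some d) + row_rank (prev_col b) (next_col d))%N.
Proof.
move=> le_bd; have bI : b \in A_segment b d by rewrite inE leqnn.
have dI : d \in A_segment b d by rewrite inE leqnn le_bd.
have [Y [h [exit exit' hE]]] := exit_map b d.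
have [X [g [entry entry' gE]]] := entry_map b d.
have from : {in A_segment b d, forall c : 'I_n,
    inhabited (@qpath (CL n) (b, j) (c, j))}.
  move=> c; rewrite inE => /andP[bc _]; apply: CL_pathP.
  by rewrite /= bc implybb.
have to : {in A_segment b d, forall c : 'I_n,
    inhabited (@qpath (CL n) (c, j) (d, j))}.
  move=> c; rewrite inE => /andP[_ cd]; apply: CL_pathP.
  by rewrite /= cd implybb.
have [p] := from d dI.
have rk := multiplicity_pairing_rank (row_rep M j) (@A_segment_connected n b d)
  dI (rep_iso_refl _).
have E := pullback_rank_formula commM row_arrow_path
  (@A_segment_connected n b d) bI dI from to (p01 := p) exit entry
  (fun a sI tI p' x => exit' a sI tI _ p p' x)
  (fun a sI tI p' psi => entry' a sI tI _ p p' psi) rk.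
rewrite /row_rank (rank_betweenE commM p).
have fgE : \dim (limg (composite M p \o g)) =
    if prev_col b is Some b' then rank_between M (b', j) (d, j) else 0.
  case: (prev_col b) gE => [b'|] gE; last by rewrite gE comp_lfun0r lim0g dimv0.
  have [r Er] := gE _ p; have := Er _ \1%VF; rewrite !comp_lfun1l => ->.
  by rewrite (rank_betweenE commM r).
have hfE : \dim (limg (h \o composite M p)) =
    if next_col d is Some d' then rank_between M (b, j) (d', j) else 0.
  case: (next_col d) hE => [d'|] hE; first exact: hE.
  by rewrite hE comp_lfun0l lim0g dimv0.
have hfgE : \dim (limg (h \o composite M p \o g)) =
    if prev_col b is Some b' then
      if next_col d is Some d' then rank_between M (b', j) (d', j) else 0
    else 0.
  case: (prev_col b) gE => [b'|] gE; last by rewrite gE comp_lfun0r lim0g dimv0.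
  have [r ->] := gE _ p; case: (next_col d) hE => [d'|] hE; first exact: hE.
  by rewrite hE comp_lfun0l lim0g dimv0.
by move: E; rewrite fgE hfE hfgE.
Qed.
End Rows.

(** * Inclusion-exclusion for the interval approximation *)

Section RowParts.
Variables (n : nat) (j : bool).
Implicit Types (J : qinterval (CL n)) (b d : 'I_n).

Definition row_part J : {set A_quiver n} :=
  [set i : 'I_n | (i, j) \in qinterval_set J].

Definition meets_at (o : option 'I_n) J : bool :=
  if o is Some i then (i, j) \in qinterval_set J else false.

Lemma row_convex J (u v w : 'I_n) : (u, j) \in qinterval_set J ->
  (v, j) \in qinterval_set J -> u <= w <= v -> (w, j) \in qinterval_set J.
Proof.
have /asboolP[_ _ /CL_convexP cvx] := qintervalP J.
move=> uJ vJ /andP[uw wv].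
by apply: (cvx (u, j) (v, j)); rewrite //= ?uw ?wv implybb.
Qed.

(** The part of J in row j is itself a segment by convexity, hence determined by
    its two ends. *)
Lemma row_part_segment J b d : b <= d ->
  (row_part J == A_segment b d) =
  [&& meets_at (Some b) J, meets_at (Some d) J,
      ~~ meets_at (prev_col b) J & ~~ meets_at (next_col d) J].
Proof.
move=> le_bd; apply/eqP/and4P => [/setP E|[/= bJ dJ nb nd]].
  have mem i : ((i, j) \in qinterval_set J) = (b <= i <= d).
    by have := E i; rewrite !inE.
  rewrite /= !mem !leqnn le_bd; split=> //.
    case Eb: (prev_col b) => [i|] //=; rewrite mem negb_and -ltnNge.
    by have /eqP := Eb; rewrite prev_colP => /eqP <-; rewrite leqnn.
  case Ed: (next_col d) => [i|] //=; rewrite mem negb_and -!ltnNge.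
  by have /eqP := Ed; rewrite next_colP => /eqP ->; rewrite leqnn orbT.
apply/setP => i; rewrite !inE; apply/idP/idP => [iJ|]; last exact: row_convex.
rewrite leqNgt [i <= d]leqNgt; apply/andP; split.
  apply: contra nb => ib.
  have lb : b.-1 < n by apply: leq_ltn_trans (leq_pred _) (ltn_ord b).
  have -> : prev_col b = Some (Ordinal lb).
    by apply/eqP; rewrite prev_colP /= prednK // (leq_ltn_trans _ ib).
  apply: (row_convex iJ bJ); rewrite /= leq_pred andbT -ltnS prednK //.
  exact: leq_ltn_trans ib.
apply: contra nd => di; have ld : d.+1 < n by apply: leq_ltn_trans (ltn_ord i).
have -> : next_col d = Some (Ordinal ld) by apply/eqP; rewrite next_colP.
by apply: (row_convex dJ iJ); rewrite /= leqnSn.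
Qed.

Lemma segment_sub J b d : b <= d ->
  (CL_segment j b d \subset qinterval_set J) =
  meets_at (Some b) J && meets_at (Some d) J.
Proof.
move=> le_bd; apply/subsetP/andP => [sub|[/= bJ dJ] [i j']].
  by split; apply: sub; rewrite inE /= leqnn ?le_bd eqxx.
by rewrite inE /= => /andP[bid /eqP ->]; apply: row_convex bJ dJ bid.
Qed.

Lemma row_part_row_intervals J j' : J \in row_intervals n j' ->
  exists b d, [/\ b <= d, qinterval_set J = CL_segment j' b d &
    row_part J = if j' == j then A_segment b d else set0].
Proof.
rewrite inE => /existsP[b /existsP[d /andP[le_bd /eqP E]]].
exists b, d; split=> //; apply/setP => i; rewrite inE E inE /= [j == j']eq_sym.
by case: eqP => _; rewrite !inE ?andbT ?andbF.
Qed.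

Lemma row_part_two_row J : J \in two_row_intervals n ->
  exists b d b' d', [/\ b <= d, b' <= d',
    qinterval_set J = CL_segment (~~ j) b' d' :|: CL_segment j b d &
    row_part J = A_segment b d].
Proof.
rewrite inE => /existsP[b1 /existsP[d1 /existsP[b2 /existsP[d2]]]].
move=> /and4P[le1 le2 le3 /eqP E].
have le_bd1 := leq_trans le2 le3; have le_bd2 := leq_trans le1 le2.
rewrite /row_part E; case: (j) => /=.
  exists b2, d2, b1, d1; split=> //; apply/setP => i.
  by rewrite !inE /= andbF andbT.
exists b1, d1, b2, d2; split=> //; first by rewrite setUC.
by apply/setP => i; rewrite !inE /= andbF andbT orbF.
Qed.

(** An interval whose part in row j is [b,d] either lies in row j, and is then
    the segment itself, or meets both rows and belongs to the sum in [tilde]. *)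
Lemma row_part_extends J b d (le_bd : b <= d) :
  (row_part J == A_segment b d) && (J != row_interval j le_bd) =
  (J \in two_row_intervals n) &&
    [exists b' : 'I_n, exists d' : 'I_n,
       qinterval_set J == CL_segment (~~ j) b' d' :|: row_interval j le_bd].
Proof.
apply/idP/idP => [/andP[/eqP E nJ]|/andP[J2 /existsP[b' /existsP[d' /eqP EJ]]]].
  have [J1|] := boolP (J \in row_intervals n j).
    have [b0 [d0 [_ EJ]]] := row_part_row_intervals J1; rewrite eqxx E => Es.
    case/eqP: nJ; apply: val_inj; rewrite /= EJ; apply/setP => -[i j'].
    by have /setP/(_ i) := Es; rewrite !inE /= => ->.
  have [J1|nJ1 nJ1'] := boolP (J \in row_intervals n (~~ j)).
    have [b0 [d0 [_ EJ]]] := row_part_row_intervals J1; rewrite E.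
    have -> : (~~ j == j) = false by case: (j).
    by move=> /setP/(_ b); rewrite !inE leqnn le_bd.
  have J2 : J \in two_row_intervals n.
    have := in_setT J.
    rewrite CL_intervalsE !in_setU; move: nJ1 nJ1'.
    by case: (j) => /= /negPf-> /negPf->.
  rewrite J2; have [b0 [d0 [b' [d' [_ _ EJ Es]]]]] := row_part_two_row J2.
  apply/existsP; exists b'; apply/existsP; exists d'; rewrite EJ.
  apply/eqP; congr (_ :|: _); apply/setP => -[i j'].
  by have := Es; rewrite E => /setP/(_ i); rewrite !inE /= => ->.
have [b0 [d0 [b1 [d1 [le0 le1 EJ' Es]]]]] := row_part_two_row J2.
apply/andP; split.
  apply/eqP/setP => i; rewrite inE EJ !inE /= eqxx andbT.
  by case: (j); rewrite andbF.
apply/eqP => EI; have : (b1, ~~ j) \in qinterval_set J.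
  by rewrite EJ' !inE /= leqnn le1 eqxx.
by rewrite EI !inE /=; case: (j); rewrite andbF.
Qed.

Lemma tilde_row (delta : qinterval (CL n) -> int) b d (le_bd : b <= d) :
  tilde delta (row_interval j le_bd) =
  (\sum_(J | row_part J == A_segment b d) delta J)%R.
Proof.
have rowI : row_interval j le_bd \in row_intervals n j.
  rewrite inE; apply/existsP; exists b; apply/existsP; exists d.
  by rewrite le_bd eqxx.
have partI : row_part (row_interval j le_bd) == A_segment b d.
  by apply/eqP/setP => i; rewrite !inE /= eqxx andbT.
rewrite (bigD1 (row_interval j le_bd)) //=.
rewrite (eq_bigl _ _ (fun J => row_part_extends J le_bd)).
have notlow : j -> row_interval j le_bd \notin row_intervals n false.
  move=> jT; apply/negP => /row_part_row_intervals[b0 [d0 [_ _]]].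
  by rewrite (eqP partI) jT /= => /setP/(_ b); rewrite !inE leqnn le_bd.
rewrite /tilde; case: j rowI notlow {partI} => rowI notlow;
  last by rewrite rowI.
rewrite (negPf (notlow isT)) rowI; congr (_ + _)%R; apply: eq_bigl => J.
congr (_ && _); apply: eq_existsb => b'; apply: eq_existsb => d'.
by rewrite setUC.
Qed.

(** Valid term by term, since by convexity J contains every vertex of its row
    that lies between two of its vertices. *)
Lemma row_inclusion_exclusion (delta : qinterval (CL n) -> int) b d : b <= d ->
  let D o1 o2 := (\sum_(J | meets_at o1 J && meets_at o2 J) delta J)%R in
  (\sum_(J | row_part J == A_segment b d) delta J
     + D (Some b) (next_col d) + D (prev_col b) (Some d) =
   D (Some b) (Some d) + D (prev_col b) (next_col d))%R.
Proof.
move=> le_bd D; rewrite /D [X in (X + _ + _)%R]big_mkcond.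
rewrite [X in (_ + X + _)%R]big_mkcond.
rewrite [X in (_ + X = _)%R]big_mkcond [X in (_ = X + _)%R]big_mkcond.
rewrite [X in (_ = _ + X)%R]big_mkcond -!big_split.
apply: eq_bigr => J _ /=; rewrite row_part_segment //=.
have pd_b : meets_at (prev_col b) J -> (d, j) \in qinterval_set J ->
    (b, j) \in qinterval_set J.
  case E: (prev_col b) => [i|] //= iJ dJ; apply: row_convex iJ dJ _.
  by have /eqP := E; rewrite prev_colP le_bd andbT => /eqP <-.
have bn_d : (b, j) \in qinterval_set J -> meets_at (next_col d) J ->
    (d, j) \in qinterval_set J.
  case E: (next_col d) => [i|] //= bJ iJ; apply: row_convex bJ iJ _.
  by have /eqP := E; rewrite next_colP le_bd => /eqP ->; rewrite leqnSn.
have pn_b : meets_at (prev_col b) J -> meets_at (next_col d) J ->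
    (b, j) \in qinterval_set J.
  case Eb: (prev_col b) => [i|] //=; case Ed: (next_col d) => [i'|] //= iJ i'J.
  apply: row_convex iJ i'J _; have /eqP := Eb; have /eqP := Ed.
  rewrite prev_colP next_colP => /eqP -> /eqP ib.
  by rewrite -{1}ib leqnSn (leq_trans le_bd).
move: pd_b bn_d pn_b; move: (meets_at (prev_col b) J) (meets_at (next_col d) J).
move: ((b, j) \in qinterval_set J) ((d, j) \in qinterval_set J).
case=> [] [] [] [] /= H1 H2 H3; rewrite ?addr0 ?add0r //;
  by [have := H1 isT isT | have := H2 isT isT | have := H3 isT isT].
Qed.
End RowParts.

Section Compressed.
Variables (k : fieldType) (n : nat) (xi : qinterval (CL n) -> course (CL n)).
Hypothesis essxi : essential_assignment xi.
Variable M : rep k (CL n).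
Hypothesis commM : commutative_rep M.
Variable j : bool.

Lemma segment_ends_essential (b d : 'I_n) : b <= d ->
  ((b, j) \in essential_vertices (CL_segment j b d)) &&
  ((d, j) \in essential_vertices (CL_segment j b d)).
Proof.
move=> le_bd; rewrite !inE /= !leqnn le_bd eqxx /=.
apply/andP; split; apply/orP; [left | right];
  apply/forallP => -[[[s js] [t jt]] /= st]; apply/implyP => /eqP[E Ej];
  rewrite inE /=; apply/negP => /andP[/andP[Hb Hd] /eqP Ej'];
  move: st; rewrite /CL_rel /= E Ej Ej' /A_rel /= eqxx /=;
  move=> /orP[/eqP Es|/and3P[_ nj jj]].
- by rewrite -Es ltnn in Hb.
- by rewrite jj in nj.
- by rewrite -Es ltnn in Hd.
- by rewrite jj in nj.
Qed.

(** The ends of a segment are its source and sink, so every essential course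
    passes through both. *)
Lemma compressed_multiplicity_segment (b d : 'I_n) (le_bd : b <= d) :
  compressed_multiplicity xi M (row_interval j le_bd) =
  rank_between M (b, j) (d, j).
Proof.
have /andP[/subsetP ess sub] := essxi (row_interval j le_bd).
have /andP[/ess/imsetP[c0 _ E0] /ess/imsetP[c1 _ E1]] :=
  segment_ends_essential le_bd.
have /asboolP[_ _ cvx] := qintervalP (row_interval j le_bd).
have inI (c : cquiver (xi (row_interval j le_bd))) :
    (b <= (cmap c).1 <= d) && ((cmap c).2 == j).
  have : cmap c \in [set cmap c' | c' : cquiver (xi (row_interval j le_bd))].
    by apply/imsetP; exists c.
  by move=> /(subsetP sub); rewrite inE.
rewrite E0 E1; apply: tour_multiplicity => // c.
  rewrite -E0; apply: CL_pathP => /=.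
  by have /andP[/andP[-> _] /eqP->] := inI c; rewrite implybb.
rewrite -E1; apply: CL_pathP => /=.
by have /andP[/andP[_ ->] /eqP->] := inI c; rewrite implybb.
Qed.

Lemma approx_superset_sum (o1 o2 : option 'I_n) :
  (forall b d, o1 = Some b -> o2 = Some d -> b <= d) ->
  (\sum_(J | meets_at j o1 J && meets_at j o2 J) interval_approx xi M J)%R =
  Posz (row_rank M j o1 o2).
Proof.
case: o1 => [b|] le12; last by rewrite big_pred0.
case: o2 le12 => [d|] le12; last by rewrite big_pred0 // => J; rewrite andbF.
have le_bd := le12 _ _ erefl erefl.
rewrite /row_rank -(compressed_multiplicity_segment le_bd).
rewrite /interval_approx; case: cid => delta /= ->.
by apply: eq_bigl => J; rewrite -(segment_sub _ _ le_bd).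
Qed.

Lemma row_multiplicity_tilde (b d : 'I_n) (le_bd : b <= d) :
  Posz (multiplicity (row_rep M j) (interval_rep k (A_segment b d))) =
  tilde (interval_approx xi M) (row_interval j le_bd).
Proof.
rewrite tilde_row.
(* Each of the four pairs of columns is in increasing order, so that it bounds
   a segment. *)
have le_bn b' d' : Some b = Some b' -> next_col d = Some d' -> b' <= d'.
  case=> <- /eqP; rewrite next_colP => /eqP ->; exact: leqW.
have le_pd b' d' : prev_col b = Some b' -> Some d = Some d' -> b' <= d'.
  move=> /eqP; rewrite prev_colP => /eqP ib [<-].
  by apply: leq_trans le_bd; rewrite -ib.
have le_pn b' d' : prev_col b = Some b' -> next_col d = Some d' -> b' <= d'.
  move=> pb nd; apply: leq_trans (le_pd _ _ pb erefl) _.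
  by move/eqP: nd; rewrite next_colP => /eqP ->.
have le_bd' b' d' : Some b = Some b' -> Some d = Some d' -> b' <= d'.
  by case=> <- [<-].
have := row_inclusion_exclusion j (interval_approx xi M) le_bd.
rewrite /= (approx_superset_sum le_bn) (approx_superset_sum le_pd).
rewrite (approx_superset_sum le_bd') (approx_superset_sum le_pn).
have := row_multiplicity commM j le_bd => /(congr1 Posz); rewrite !PoszD => <-.
by move=> /addIr/addIr.
Qed.
End Compressed.

Theorem proposition4p6 (k : fieldType) (n : nat) (hn : 1 <= n)
    (xi : qinterval (CL n) -> course (CL n))
    (hxi : essential_assignment xi)
    (M : rep k (CL n)) (hM : commutative_rep M) :
  (forall (b d : 'I_n) (hbd : b <= d),
     Posz (multiplicity (row_rep M lower_row)
                        (interval_rep k (A_segment b d))) =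
     tilde (interval_approx xi M) (row_interval lower_row hbd)) /\
  (forall (b d : 'I_n) (hbd : b <= d),
     Posz (multiplicity (row_rep M upper_row)
                        (interval_rep k (A_segment b d))) =
     tilde (interval_approx xi M) (row_interval upper_row hbd)).
Proof. by split=> b d hbd; apply: row_multiplicity_tilde. Qed.
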